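(* Let $n$ be a positive integer and let $X,Y$ be random bipartite graphs chosen independently from $\mathcal{G}(K_{n,n},p)$. If $$p\geq\frac{\exp\left(10(\log n)^{4/5}\right)}{n^{1/2}},$$ then with high probability (probability tending to $1$ as $n\to\infty$) the graph $\mathsf{FS}(X,Y)$ has exactly two connected components.
   Context: For simple graphs $X,Y$ with the same number of vertices, $\mathsf{FS}(X,Y)$ has as vertices all bijections $\sigma:V(X)\to V(Y)$, with $\sigma,\tau$ adjacent if $\sigma=\tau\circ(a\ b)$ for some $ab\in E(X)$ with $\sigma(a)\sigma(b)\in E(Y)$. $\mathcal{G}(K_{n,n},p)$ denotes the random spanning subgraph of the complete bipartite graph $K_{n,n}$ (parts of size $n$) in which each edge is kept independently with probability $p$. *)

(* Defs.v *)
From HB Require Import structures.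
From mathcomp Require Import all_boot all_order all_algebra all_fingroup.
From mathcomp Require Import reals.

Set Implicit Arguments.
Unset Strict Implicit.
Unset Printing Implicit Defensive.

Import GRing.Theory.

Record sgraph (T : finType) := SGraph {
  edge :> rel T;
  edge_sym : symmetric edge;
  edge_irrefl : irreflexive edge
}.

Definition ncomponents (T : finType) (X : sgraph T) : nat := n_comp X T.

(* The two graphs share the vertex type T, so that bijections V(X) -> V(Y) are
   the elements of {perm T}.  Since (s * t) x = t (s x) in {perm T}, the
   composition t \o (a b) is written tperm a b * t. *)
Definition fs_rel (T : finType) (X Y : sgraph T) : rel {perm T} :=
  fun s t => [exists a, exists b,
    [&& X a b, Y (s a) (s b) & s == (tperm a b * t)%g]].

Lemma fs_rel_sym (T : finType) (X Y : sgraph T) : symmetric (fs_rel X Y).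
Proof.
suff H : forall s t, fs_rel X Y s t -> fs_rel X Y t s.
  by move=> s t; apply/idP/idP; apply: H.
move=> s t /existsP [a /existsP [b /and3P [Xab Yab /eqP Es]]].
apply/existsP; exists a; apply/existsP; exists b.
rewrite Xab Es mulgA tperm2 mul1g eqxx andbT /=.
by move: Yab; rewrite Es !permM tpermL tpermR edge_sym.
Qed.

Lemma fs_rel_irrefl (T : finType) (X Y : sgraph T) : irreflexive (fs_rel X Y).
Proof.
move=> s; apply/negbTE/negP => /existsP [a /existsP [b /and3P [Xab _ /eqP Es]]].
have sab : s a = s b by rewrite {1}Es permM tpermL.
by move: Xab; rewrite (perm_inj sab) edge_irrefl.
Qed.

Definition FS (T : finType) (X Y : sgraph T) : sgraph {perm T} :=
  SGraph (@fs_rel_sym T X Y) (@fs_rel_irrefl T X Y).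

(* Spanning subgraphs of K_{n,n}: the vertex set is 'I_n + 'I_n, and the pair
   (i, j) stands for the edge joining inl i to inr j. *)
Definition bip_rel (n : nat) (E : {set 'I_n * 'I_n}) : rel ('I_n + 'I_n) :=
  fun u v => match u, v with
    | inl i, inr j => (i, j) \in E
    | inr j, inl i => (i, j) \in E
    | _, _ => false
    end.

Lemma bip_rel_sym (n : nat) (E : {set 'I_n * 'I_n}) : symmetric (bip_rel E).
Proof. by move=> [i|i] [j|j]. Qed.

Lemma bip_rel_irrefl (n : nat) (E : {set 'I_n * 'I_n}) :
  irreflexive (bip_rel E).
Proof. by move=> [i|i]. Qed.

Definition bip_graph (n : nat) (E : {set 'I_n * 'I_n}) :
    sgraph ('I_n + 'I_n)%type :=
  SGraph (@bip_rel_sym n E) (@bip_rel_irrefl n E).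

Local Open Scope ring_scope.

(* Probability that the edge set of a sample of G(K_{n,n}, p) is E. *)
Definition bip_mass (R : realType) (n : nat) (p : R)
    (E : {set 'I_n * 'I_n}) : R :=
  \prod_(e : 'I_n * 'I_n) (if e \in E then p else 1 - p).

Lemma bip_mass_sum1 (R : realType) (n : nat) (p : R) :
  \sum_(E : {set 'I_n * 'I_n}) bip_mass p E = 1.
Proof.
rewrite /bip_mass -bigA_distr.
by rewrite big1 // => e _ /=; rewrite addrC subrK.
Qed.

(* Probability of the event A(X, Y) for X, Y independent samples of
   G(K_{n,n}, p). *)
Definition bip_pair_prob (R : realType) (n : nat) (p : R)
    (A : sgraph ('I_n + 'I_n)%type -> sgraph ('I_n + 'I_n)%type -> bool) : R :=
  \sum_(EX : {set 'I_n * 'I_n}) \sum_(EY : {set 'I_n * 'I_n} |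
     A (bip_graph EX) (bip_graph EY)) bip_mass p EX * bip_mass p EY.

(* Main.v *)
Require Import Defs.
From HB Require Import structures.
From mathcomp Require Import all_boot all_order all_algebra all_fingroup.
From mathcomp Require Import zify ring lra.
From mathcomp Require Import reals.

(** A state is a permutation s placing the person s x on the position x.  Two
    persons can be exchanged along an edge of X if they are adjacent in Y, and
    the parity of s plus that of the number of left persons on left positions
    is invariant, so there are at least two components.

    Conversely, the key is to bring any prescribed person to any prescribed
    position without touching a few frozen positions.  Any m
    persons of one side jointly reach almost all positions: for m of order n
    this follows from the abundance of possible moves.  It is then propagated
    down to m of order p n: freeze m/16 persons; their Y-neighbourhoods are
    large, so by induction friends of these persons reach almost everything,
    and the set of positions they reach does not depend on the X-edges at the
    frozen positions.  These fresh edges let some frozen person move to a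
    prescribed large set, except with a probability that beats the union bound
    over all states and all auxiliary sets.  Two more applications of the same
    principle give the statement for any two sets of order (log n) / p, and then
    for a single person and a single position, by first surrounding the target
    position with friends of the person.

    Finally, if u and v are adjacent in Y and sit on a and b, take three disjoint
    paths of length three from a to b in X, place neighbours of u on their inner
    vertices, and slide u around as in the fifteen puzzle: this exchanges u and
    v.  Hence X, and symmetrically Y, may be replaced by the complete bipartite
    graph, for which the two classes of the invariant are easily connected. *)

Set Implicit Arguments.
Unset Strict Implicit.
Unset Printing Implicit Defensive.

(** * Cardinalities of finite sets *)

Section FiniteSets.
Variable T : finType.
Implicit Types A B W : {set T}.

Lemma subset_of_card A m : m <= #|A| -> exists2 B : {set T}, B \subset A & #|B| = m.
Proof.
move=> mA; exists [set x in take m (enum A)].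
  by apply/subsetP=> x; rewrite inE => /mem_take; rewrite mem_enum.
rewrite cardsE; have /card_uniqP -> : uniq (take m (enum A)) by rewrite take_uniq ?enum_uniq.
by rewrite size_takel // -cardE.
Qed.

Lemma superset_of_card A m : #|A| <= m -> m <= #|T| ->
  exists2 B : {set T}, A \subset B & #|B| = m.
Proof.
move=> Am mT.
have [|C /subsetP CA cC] := @subset_of_card (~: A) (m - #|A|).
  by have := cardsC A; lia.
exists (A :|: C); first exact: subsetUl.
rewrite cardsU (_ : A :&: C = set0) ?cards0 ?cC; first by lia.
by apply/setP=> x; rewrite !inE; apply/negP=> /andP[xA /CA]; rewrite inE xA.
Qed.

Lemma card_bigcup_leq (I : finType) (f : I -> {set T}) (A : {set I}) :
  #|\bigcup_(z in A) f z| <= \sum_(z in A) #|f z|.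
Proof.
apply: (big_rec2 (fun (x : {set T}) y => #|x| <= y)) => [|i y x _ le_xy].
  by rewrite cards0.
by rewrite cardsU; lia.
Qed.

(** Fewer than [g] elements [z] of [W] have [g * #|f z| < d], since [g] of them would have a union
    of fewer than [d] elements; each of the others contributes at least [d / g]. *)
Lemma sum_card_lower (f : T -> {set T}) W g d :
    (forall B : {set T}, B \subset W -> #|B| = g -> d <= #|\bigcup_(z in B) f z|) ->
  (#|W| - g) * d <= g * \sum_(z in W) #|f z|.
Proof.
case: (posnP g) => [->|g0] Hg.
  rewrite (_ : d = 0) ?muln0 //; apply/eqP; rewrite -leqn0.
  by have := Hg set0 (sub0set _) (cards0 _); rewrite big_set0 cards0.
pose B := [set z in W | g * #|f z| < d].
have ltB : #|B| < g.
  rewrite ltnNge; apply/negP=> /subset_of_card [B0 B0B cB0].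
  have B0W : B0 \subset W.
    by apply: subset_trans B0B _; apply/subsetP=> z; rewrite inE => /andP[].
  have le1 := leq_trans (Hg _ B0W cB0) (card_bigcup_leq _ _).
  have : g * \sum_(z in B0) #|f z| + g <= g * d.
    rewrite big_distrr /= -cB0 -[X in _ + X <= _]muln1 -!sum_nat_const -big_split /=.
    apply: leq_sum => z /(subsetP B0B); rewrite inE => /andP[_].
    by rewrite addn1 cB0.
  by nia.
rewrite big_distrr /= (bigID (mem B)) /= addnC; apply: leq_trans (leq_addr _ _).
apply: (@leq_trans (\sum_(z in W | z \notin B) d)); last first.
  by apply: leq_sum => z /andP[zW]; rewrite !inE zW -leqNgt.
rewrite (eq_bigl (mem (W :\: B))) => [|z]; last by rewrite !inE andbC.
rewrite sum_nat_const leq_mul2r; apply/orP; right.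
by rewrite cardsD; have := subset_leq_card (subsetIr W B); lia.
Qed.

Lemma leq_card_setD A B : #|A| <= #|A :\: B| + #|B|.
Proof. by rewrite cardsD; have := subset_leq_card (subsetIr A B); lia. Qed.

Lemma disjointP_in A B : [disjoint A & B] -> forall x, x \in A -> x \notin B.
Proof. by rewrite disjoint_subset => /subsetP h x /h; rewrite inE. Qed.

End FiniteSets.

(** * Swap sequences that leave a set of positions frozen *)

Section Moves.
Variables (V : finType) (X Y : rel V).
Implicit Types (s t u : {perm V}) (F : {set V}).

Definition mv F : rel {perm V} := fun s t => [exists a, exists b,
  [&& X a b, Y (s a) (s b), a \notin F, b \notin F & t == (tperm a b * s)%g]].

Definition reach F : rel {perm V} := connect (mv F).

Lemma mvP F s t : reflect (exists a b, [/\ X a b, Y (s a) (s b), a \notin F, b \notin F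
  & t = (tperm a b * s)%g]) (mv F s t).
Proof.
apply: (iffP existsP) => [[a /existsP[b /and5P[? ? ? ? /eqP ?]]]|[a [b [? ? ? ? ->]]]].
  by exists a, b.
by exists a; apply/existsP; exists b; apply/and5P; split.
Qed.

Lemma reach_refl F s : reach F s s. Proof. exact: connect0. Qed.

Lemma reach_trans F t s u : reach F s t -> reach F t u -> reach F s u.
Proof. exact: connect_trans. Qed.

Lemma reach_swap F s t a b : reach F s t -> X a b -> Y (t a) (t b) ->
  a \notin F -> b \notin F -> reach F s (tperm a b * t)%g.
Proof.
move=> st Xab Yab aF bF; apply: connect_trans st (connect1 _).
by apply/mvP; exists a, b.
Qed.

Lemma reach_ind F s (P : {perm V} -> Prop) : P s ->
  (forall t a b, reach F s t -> P t -> X a b -> Y (t a) (t b) -> a \notin F ->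
     b \notin F -> P (tperm a b * t)%g) -> forall t, reach F s t -> P t.
Proof.
move=> Ps Pstep t /connectP[p + ->].
elim/last_ind: p t => [|p x IHp] t //=; rewrite rcons_path last_rcons => /andP[pp].
move=> /mvP[a [b [Xab Yab aF bF ->]]].
by apply: Pstep => //; [apply/connectP; exists p | apply: IHp].
Qed.

Lemma reach_fix F s t : reach F s t -> {in F, t =1 s}.
Proof.
move=> st x xF; move: t st; apply: reach_ind => // t a b _ tx _ _ aF bF.
by rewrite permM tpermD //; [apply: contraNneq aF => ->|apply: contraNneq bF => ->].
Qed.

Lemma reach_sub F F' s t : F' \subset F -> reach F s t -> reach F' s t.
Proof.
move=> /subsetP sFF; move: t; apply: reach_ind => [|t a b _ st Xab Yab aF bF].
  exact: reach_refl.
by apply: reach_swap => //; [apply: contra aF|apply: contra bF] => /sFF.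
Qed.

(** Basis of the extremal arguments below: in a state that maximizes a potential, a reachable swap
    increasing the potential is contradictory. *)
Lemma reach_max F s (phi : {perm V} -> nat) :
  exists2 t, reach F s t & forall u, reach F t u -> phi u <= phi t.
Proof.
case: (arg_maxnP phi (reach_refl F s)) => t st tmax.
by exists t => // u tu; apply: tmax; apply: reach_trans tu.
Qed.

Lemma mv_sym F : symmetric X -> symmetric Y -> symmetric (mv F).
Proof.
move=> Xs Ys; suff H : forall s t, mv F s t -> mv F t s.
  by move=> s t; apply/idP/idP; apply: H.
move=> s t /mvP[a [b [Xab Yab aF bF ->]]]; apply/mvP; exists a, b; split => //.
  by rewrite !permM tpermL tpermR Ys.
by rewrite mulgA tperm2 mul1g.
Qed.

Lemma reach_sym F : symmetric X -> symmetric Y -> symmetric (reach F).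
Proof. by move=> Xs Ys; apply: sym_connect_sym; apply: mv_sym. Qed.

(** Here [T] consists of persons and [Q] of positions, although both are subsets of [V]. *)
Definition hits F s (T Q : {set V}) : bool :=
  [exists t, reach F s t && [exists y in Q, t y \in T]].

Lemma hitsP F s (T Q : {set V}) :
  reflect (exists t y, [/\ reach F s t, y \in Q & t y \in T]) (hits F s T Q).
Proof.
apply: (iffP existsP) => [[t /andP[st /existsP[y /andP[yQ tyT]]]]|[t [y [st yQ tyT]]]].
  by exists t, y.
by exists t; rewrite st; apply/existsP; exists y; rewrite yQ.
Qed.

Definition nbr (U : {set V}) : {set V} := [set y | [exists x in U, Y x y]].

End Moves.

(** * Pseudorandomness conditions for bipartite graphs *)

Section Sides.
Variables (V : finType) (side : V -> bool).
Implicit Types (A B U F W Q T : {set V}) (s t : {perm V}).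

Definition sd (b : bool) : {set V} := [set x | side x == b].

Definition bipartite (R : rel V) := forall x y, R x y -> side y = ~~ side x.

Definition edge_between (e : nat) (R : rel V) := forall b A B,
  A \subset sd b -> B \subset sd (~~ b) -> e <= #|A| -> e <= #|B| ->
  exists x y, [/\ x \in A, y \in B & R x y].

Definition expanding (n D : nat) (R : rel V) := forall b U,
  U \subset sd b -> #|U| * D * 2 <= n -> #|U| * D <= #|nbr R U|.

(* The positions y of Q at which a neighbour of the person s z can be brought
   without touching F, while further neighbours of s z occupy all the
   positions x with (z, x) in H. *)
Definition avail (X Y : rel V) s F (H : {set V * V}) Q (P : {set V}) (z : V) : {set V} :=
  [set y in Q | [&& y \notin F, side y != side z, (z, y) \notin H &
    [exists t, reach X Y F s t && [forall x, ((x == y) || ((z, x) \in H)) ==>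
       (t x \in P) && Y (s z) (t x)]]]].

(* For fixed data, the sets [avail] only depend on the edges of X outside F,
   so that the edges between W and these sets are still independent of them. *)
Definition joint (n e : nat) (X Y : rel V) := forall s F W (H : {set V * V}) Q (P : {set V}),
  W \subset F -> #|H| <= n ->
  n * e <= \sum_(z in W) #|avail X Y s F H Q P z| ->
  exists z y, [/\ z \in W, y \in avail X Y s F H Q P z & X z y].

Lemma availP X Y s F (H : {set V * V}) Q (P : {set V}) z y :
  reflect [/\ y \in Q, y \notin F, side y != side z, (z, y) \notin H &
    exists2 t, reach X Y F s t &
      forall x, (x == y) || ((z, x) \in H) -> t x \in P /\ Y (s z) (t x)]
   (y \in avail X Y s F H Q P z).
Proof.
rewrite inE; apply: (iffP andP) => [[yQ /and4P[yF yz yH]]|[yQ yF yz yH [t st tx]]].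
  move=> /existsP[t /andP[st /forallP tx]]; split=> //; exists t => // x xH.
  by have /implyP/(_ xH)/andP := tx x.
split=> //; apply/and4P; split=> //; apply/existsP; exists t; rewrite st.
by apply/forallP => x; apply/implyP=> /tx/andP.
Qed.

Lemma mem_avail0 X Y s F Q (P : {set V}) z y t :
  y \in Q -> y \notin F -> side y != side z -> reach X Y F s t ->
  t y \in P -> Y (s z) (t y) -> y \in avail X Y s F set0 Q P z.
Proof.
move=> yQ yF yz st tyP Yz; apply/availP; split; rewrite ?inE //.
by exists t => // x; rewrite inE orbF => /eqP->.
Qed.

Lemma in_sdE b x : (x \in sd b) = (side x == b).
Proof. by rewrite inE. Qed.

Lemma in_sd A b x : A \subset sd b -> x \in A -> side x = b.
Proof. by move=> /subsetP/[apply]; rewrite in_sdE => /eqP. Qed.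

Lemma card_preim s T : #|[set x | s x \in T]| = #|T|.
Proof.
rewrite -(card_imset T (@perm_inj _ s^-1%g)); apply: eq_card => x; rewrite inE.
apply/idP/imsetP => [sT|[y yT ->]]; last by rewrite permKV.
by exists (s x); rewrite ?permK.
Qed.

Lemma card_sub_side s j T :
  #|T| = #|[set x | (side x == j) && (s x \in T)]| +
         #|[set x | (side x == ~~ j) && (s x \in T)]|.
Proof.
rewrite -(card_preim s) -(cardsID [set x | side x == j]).
congr (_ + _); apply: eq_card => x; rewrite !inE; first by rewrite andbC.
by case: (side x); case: j.
Qed.

(** Each side has [n] positions and [n] persons, so both counts equal [n] minus the number of
    positions of side [j] with persons of side [~~ i]. *)
Lemma balanced n s i j : (forall b, #|sd b| = n) ->
  #|[set x | (side x == j) && (side (s x) == i)]| =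
  #|[set x | (side x == ~~ j) && (side (s x) == ~~ i)]|.
Proof.
move=> card_sd; have h1 := card_sub_side s (~~ j) (sd (~~ i)).
have h2 : #|sd j| = #|[set x | (side x == j) && (side (s x) == i)]| +
   #|[set x | (side x == j) && (side (s x) == ~~ i)]|.
  rewrite -(cardsID [set x | side (s x) == i]); congr (_ + _);
    apply: eq_card => x; rewrite !inE //.
  by case: (side (s x)); case: (i); case: (side x); case: (j).
move: h1 h2; rewrite !card_sd negbK => -> h2.
have E k : #|[set x | (side x == k) && (s x \in sd (~~ i))]| =
   #|[set x | (side x == k) && (side (s x) == ~~ i)]|.
  by apply: eq_card => x; rewrite !inE.
by move: h2; rewrite !E; lia.
Qed.

Lemma nbr_sd (R : rel V) U i : bipartite R -> U \subset sd i -> nbr R U \subset sd (~~ i).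
Proof.
move=> Rbip Ui; apply/subsetP=> y; rewrite inE => /existsP[x /andP[xU Rxy]].
by rewrite in_sdE (Rbip _ _ Rxy) (in_sd Ui xU).
Qed.

Lemma in_nbr1 (R : rel V) x y : (y \in nbr R [set x]) = R x y.
Proof.
rewrite inE; apply/existsP/idP => [[z /andP[]]|Rxy]; first by rewrite inE => /eqP->.
by exists x; rewrite inE eqxx.
Qed.

Lemma nbr1_sd (R : rel V) x : bipartite R -> nbr R [set x] \subset sd (~~ side x).
Proof.
by move=> Rbip; apply: nbr_sd => //; apply/subsetP=> y; rewrite !inE => /eqP->.
Qed.

Lemma card_nbr1 n D (R : rel V) x : D * 2 <= n -> expanding n D R -> D <= #|nbr R [set x]|.
Proof.
move=> Dn Rexp; have := @Rexp (side x) [set x]; rewrite cards1 mul1n; apply=> //.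
by apply/subsetP=> y; rewrite !inE => /eqP->.
Qed.

End Sides.

(** * Mixing and routing for a pseudorandom pair of graphs *)

Section Deterministic.
Variables (V : finType) (side : V -> bool) (X Y : rel V) (n e : nat).
Hypotheses (Xsym : symmetric X) (Ysym : symmetric Y).
Hypotheses (Xbip : bipartite side X) (Ybip : bipartite side Y).
Hypothesis card_sd : forall b, #|sd side b| = n.
Hypotheses (Xedge : edge_between side e X) (Yedge : edge_between side e Y).
Hypothesis XYjoint : joint side n e X Y.
Hypothesis e_gt0 : 0 < e.
Implicit Types (A B U F W Q T Z : {set V}) (s t u : {perm V}) (i j : bool).

Local Notation sd := (sd side).
Local Notation reach := (reach X Y).
Local Notation hits := (hits X Y).

Lemma reach_one_side F b s t : ~: F \subset sd b -> reach F s t -> t = s.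
Proof.
move=> Fb; move: t; apply: reach_ind => // t c d _ _ Xcd _ cF dF.
have h x : x \notin F -> side x = b by move=> xF; apply: in_sd Fb _; rewrite inE.
by have := Xbip Xcd; rewrite !h //; case: (b).
Qed.

Lemma card_nonadjacent (R : rel V) A B b : edge_between side e R ->
  A \subset sd b -> B \subset sd (~~ b) -> e <= #|A| ->
  #|[set y in B | ~~ [exists x in A, R x y]]| < e.
Proof.
move=> Redge Ab Bb eA; rewrite ltnNge; apply/negP=> eB.
have Bb' : [set y in B | ~~ [exists x in A, R x y]] \subset sd (~~ b).
  by apply: subset_trans Bb; apply/subsetP=> y; rewrite inE => /andP[].
have [x [y [xA + Rxy]]] := Redge _ _ _ Ab Bb' eA eB.
by rewrite inE => /andP[_] /existsP[]; exists x; rewrite xA.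
Qed.

Lemma imset_sd s A b : (forall x, x \in A -> side (s x) = b) -> s @: A \subset sd b.
Proof. by move=> h; apply/subsetP=> _ /imsetP[x xA ->]; rewrite in_sdE h. Qed.

(** Freeze everything outside [Z2]: no move is possible, so [avail] reduces to Y-adjacency in the
    state [s] itself. Any [e] persons on [Z1] are Y-adjacent to all but fewer than [e] persons on
    [Z2], so these sets are large on average and [XYjoint] supplies an X-edge. *)
Lemma active_edge s Z1 Z2 i j :
  Z1 \subset sd (~~ j) -> Z2 \subset sd j ->
  (forall x, x \in Z1 -> side (s x) = i) -> (forall x, x \in Z2 -> side (s x) = ~~ i) ->
  n * (e * e) <= (#|Z1| - e) * (#|Z2| - e) ->
  exists a b, [/\ a \in Z1, b \in Z2, X a b & Y (s a) (s b)].
Proof.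
move=> Z1j Z2j Z1i Z2i hn.
have W_F : Z1 \subset ~: Z2.
  by apply/subsetP=> x xZ; rewrite inE; apply/negP=> /(in_sd Z2j);
    rewrite (in_sd Z1j xZ); case: (j).
have rch t : reach (~: Z2) s t -> t = s by apply: (@reach_one_side _ j); rewrite setCK.
pose f z := avail side X Y s (~: Z2) set0 Z2 [set: V] z.
have sumf : (#|Z1| - e) * (#|Z2| - e) <= e * \sum_(z in Z1) #|f z|.
  apply: sum_card_lower => B BZ cB.
  have sB : s @: B \subset sd i by apply: imset_sd => x /(subsetP BZ)/Z1i.
  have sZ : s @: Z2 \subset sd (~~ i) by apply: imset_sd.
  have eB : e <= #|s @: B| by rewrite card_imset ?cB //; apply: perm_inj.
  have lt := card_nonadjacent Yedge sB sZ eB.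
  set N := [set y in _ | _] in lt.
  have : Z2 \subset [set y | s y \in N] :|: \bigcup_(z in B) f z.
    apply/subsetP=> y yZ; rewrite !inE imset_f //=.
    case: existsP => //= -[_ /andP[/imsetP[z zB ->] Yzy]].
    apply/bigcupP; exists z => //; apply: mem_avail0 (reach_refl _ _ _ _) _ _ => //.
    - by rewrite in_setC yZ.
    - rewrite (in_sd Z2j yZ) (in_sd Z1j (subsetP BZ _ zB)).
      by case: (j).
  by move=> /subset_leq_card; rewrite cardsU card_preim; lia.
have [||z [y [zZ /availP[yZ yF _ _ [t /rch-> tx]] Xzy]]] := XYjoint (s := s) (F := ~: Z2)
    (W := Z1) (H := set0) (Q := Z2) (P := setT) W_F.
- by rewrite cards0.
- by rewrite -(leq_pmul2l e_gt0); apply: leq_trans sumf; apply: leq_trans hn; lia.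
by exists z, y; split=> //; have [|] := tx y; rewrite ?eqxx.
Qed.

Definition mixing (m q : nat) := forall s F T Q i j,
  T \subset sd i -> Q \subset sd j -> [disjoint Q & F] ->
  (forall x, x \in F -> s x \notin T) -> m <= #|T| -> q <= #|Q| -> 8 * #|F| <= m ->
  hits F s T Q.

(** Assume that no person of [T] gets into [Q], and maximize [phi]. Then few positions of [Q] hold
    persons from the side of [T], and few persons of [T] stand on the side of [Q]. So many persons
    of [T] face many persons of the other side placed on [Q], and [active_edge] yields a swap into
    [Q]. *)
Lemma mixing_base m q : 100 * m <= n -> n <= 1600 * m -> n <= 10 * q ->
  1600 * (320 * (320 * (e * e))) <= n -> mixing m q.
Proof.
move=> nm nm' nq ne s F T Q i j Ti Qj QF sFT mT qQ Fm.
apply: contraT => /hitsP noh0.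
pose phi t := #|[set y in Q | side (t y) == ~~ i]| +
              #|[set x | (side x == ~~ j) && (t x \in T)]|.
have [t st tmax] := reach_max X Y F s phi.
have noh u y : reach F t u -> y \in Q -> u y \notin T.
  by move=> tu yQ; apply/negP=> uT; apply: noh0; exists u, y; split=> //; apply: reach_trans tu.
have noht y : y \in Q -> t y \notin T by apply: noh; apply: reach_refl.
have tFT x : x \in F -> t x \notin T by move=> xF; rewrite (reach_fix st xF) sFT.
have act Z1 Z2 k l : Z1 \subset sd (~~ l) -> Z2 \subset sd l ->
  (forall x, x \in Z1 -> side (t x) = k) -> (forall x, x \in Z2 -> side (t x) = ~~ k) ->
  m <= 4 * #|Z1| -> m <= 4 * #|Z2| ->
  exists a b, [/\ a \in Z1, b \in Z2, X a b & Y (t a) (t b)].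
  move=> h1 h2 h3 h4 m1 m2; apply: active_edge h1 h2 h3 h4 _.
  (* The constants fit because [320 * 320 = 64 * 1600]: both factors are at least [m / 8], and
     [m * m >= 64 * n * e * e]. *)
  have me : 320 * (320 * (e * e)) <= m by move: ne nm'; clear; lia.
  have em : 8 * e <= m by move: me e_gt0; clear; case: e => // k; nia.
  have a1 : m <= 8 * (#|Z1| - e) by move: em m1; clear; lia.
  have a2 : m <= 8 * (#|Z2| - e) by move: em m2; clear; lia.
  have := leq_mul a1 a2.
  have : m * (320 * (320 * (e * e))) <= m * m by rewrite leq_mul2l me orbT.
  have : n * (e * e) <= 1600 * m * (e * e) by rewrite leq_mul2r nm' orbT.
  move: (n * (e * e)) (e * e) => N E; move: (#|Z1| - e) (#|Z2| - e) => x y.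
  clear; move: (m * m) => mm h1 h2 h3.
  have h4 : m * (320 * (320 * E)) = 64 * (1600 * m * E) by lia.
  have h5 : 8 * x * (8 * y) = 64 * (x * y) by lia.
  by move: h1 h2 h3; rewrite h4 h5; lia.
(* By [balanced], these positions are at least as numerous, up to [#|F|], as any set of positions of
   side [j] holding persons of side [i]. *)
pose R := [set x | [&& x \notin F, side x == ~~ j & side (t x) == ~~ i]].
have R_j : R \subset sd (~~ j) by apply/subsetP=> x; rewrite !inE => /and3P[].
have R_i x : x \in R -> side (t x) = ~~ i by rewrite inE => /and3P[_ _ /eqP].
have cR Z : (forall x, x \in Z -> side x = j /\ side (t x) = i) -> #|Z| <= #|R| + #|F|.
  move=> hZ; apply: (@leq_trans #|[set x | (side x == j) && (side (t x) == i)]|).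
    by apply: subset_leq_card; apply/subsetP=> x /hZ[]; rewrite inE => -> ->; rewrite !eqxx.
  rewrite (balanced _ _ _ card_sd); apply: leq_trans (leq_subr #|R :&: F| _); rewrite -cardsU.
  apply: subset_leq_card; apply/subsetP=> x; rewrite !inE => /andP[-> ->].
  by case: (x \in F); rewrite ?orbT.
have swp a b : X a b -> Y (t a) (t b) -> a \notin F -> b \notin F ->
    reach F t (tperm a b * t)%g.
  by move=> *; apply: reach_swap => //; apply: reach_refl.
have ni : (i == ~~ i) = false by case: (i).
(* Otherwise a swap with [R] puts one more person of side [~~ i] on [Q], and no person of [T] leaves
   the side [~~ j]. *)
have stepA : 20 * #|[set y in Q | side (t y) == i]| < n.
  rewrite ltnNge; apply/negP=> big.
  have sub x : x \in [set y in Q | side (t y) == i] -> side x = j /\ side (t x) = i.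
    by rewrite inE => /andP[/(in_sd Qj)-> /eqP->].
  have cc := cR _ sub.
  have [|||||a [b [aR]]] := act R [set y in Q | side (t y) == i] (~~ i) j R_j.
  - by apply/subsetP=> x /sub[xj _]; rewrite in_sdE xj.
  - exact: R_i.
  - by move=> x /sub[_ ->]; rewrite negbK.
  - by move: cc big Fm nm; clear; lia.
  - by move: big nm; clear; lia.
  rewrite inE => /andP[bQ bi] Xab Yab.
  have aF : a \notin F by move: aR; rewrite inE => /and3P[].
  have bF : b \notin F by move: QF; rewrite disjoint_subset => /subsetP/(_ _ bQ); rewrite inE.
  have sa : side a = ~~ j by apply: in_sd R_j aR.
  have sb : side b = j by apply: in_sd Qj bQ.
  have ti : side (t a) = ~~ i := R_i _ aR.
  have := tmax _ (swp _ _ Xab Yab aF bF).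
  rewrite leqNgt => /negP; apply; rewrite /phi.
  have nab : a != b by apply/eqP=> E; move: sa; rewrite E sb; case: (j).
  apply: (@leq_trans (#|b |: [set y in Q | side (t y) == ~~ i]| +
     #|[set x | (side x == ~~ j) && (t x \in T)]|)).
    by rewrite cardsU1 inE (eqP bi) ni andbF add1n addSn.
  apply: leq_add; apply: subset_leq_card; apply/subsetP=> x.
    rewrite !inE permM; case: eqP => [->|xb] /=; first by rewrite tpermR bQ ti eqxx.
    case/andP=> xQ tx; rewrite xQ tpermD //; last by rewrite eq_sym; apply/eqP.
    by apply/eqP=> E; move: sa; rewrite E (in_sd Qj xQ); case: (j).
  rewrite !inE permM => /andP[xj xT]; rewrite xj tpermD //.
    by apply/eqP=> E; move: (in_sd Ti xT); rewrite -E ti; case: (i).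
  by apply/eqP=> E; move: xj; rewrite -E sb; case: (j).
(* Otherwise a swap with [R] moves a person of [T] to the side [~~ j]; it does not touch [Q], where
   no person of [T] stands. *)
have stepB : 2 * #|[set x | (side x == j) && (t x \in T)]| < m.
  rewrite ltnNge; apply/negP=> big.
  have sub x : x \in [set x | (side x == j) && (t x \in T)] -> side x = j /\ side (t x) = i.
    by rewrite inE => /andP[/eqP-> /(in_sd Ti)].
  have cc := cR _ sub.
  have [|||||a [b [aR]]] := act R [set x | (side x == j) && (t x \in T)] (~~ i) j R_j.
  - by apply/subsetP=> x /sub[xj _]; rewrite in_sdE xj.
  - exact: R_i.
  - by move=> x /sub[_ ->]; rewrite negbK.
  - by move: cc big Fm; clear; lia.
  - by move: big; clear; lia.
  rewrite inE => /andP[/eqP sb bT] Xab Yab.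
  have aF : a \notin F by move: aR; rewrite inE => /and3P[].
  have bF : b \notin F by apply/negP=> /tFT; rewrite bT.
  have bQ : b \notin Q by apply/negP=> /noht; rewrite bT.
  have sa : side a = ~~ j by apply: in_sd R_j aR.
  have ti : side (t a) = ~~ i := R_i _ aR.
  have := tmax _ (swp _ _ Xab Yab aF bF).
  rewrite leqNgt => /negP; apply; rewrite /phi.
  apply: (@leq_trans (#|[set y in Q | side (t y) == ~~ i]| +
     #|a |: [set x | (side x == ~~ j) && (t x \in T)]|)).
    rewrite cardsU1 inE (_ : t a \in T = false) ?andbF; first by rewrite add1n addnS.
    by apply/negP=> /(in_sd Ti); rewrite ti; case: (i).
  apply: leq_add; apply: subset_leq_card; apply/subsetP=> x.
    rewrite !inE permM => /andP[xQ tx]; rewrite xQ tpermD //.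
      by apply/eqP=> E; move: sa; rewrite E (in_sd Qj xQ); case: (j).
    by apply: contraNneq bQ => ->.
  rewrite !inE permM; case: eqP => [->|xa] /=; first by rewrite tpermL sa eqxx.
  move=> /andP[xj xT]; rewrite xj tpermD //; first by rewrite eq_sym; apply/eqP.
  by apply/eqP=> E; move: xj; rewrite -E sb; case: (j).
have cT := card_sub_side side t j T.
have cQ : #|Q| = #|[set y in Q | side (t y) == i]| + #|[set y in Q | side (t y) == ~~ i]|.
  rewrite -(cardsID [set y | side (t y) == i] Q); congr (_ + _);
    apply: eq_card => x; rewrite !inE //.
  by rewrite andbC; case: (side (t x)); case: (i).
have [||||||a [b []]] := act [set x | (side x == ~~ j) && (t x \in T)]
   [set y in Q | side (t y) == ~~ i] i j.
- by apply/subsetP=> x; rewrite !inE => /andP[].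
- by apply/subsetP=> x; rewrite inE => /andP[/(subsetP Qj)].
- by move=> x; rewrite inE => /andP[_ /(in_sd Ti)].
- by move=> x; rewrite inE => /andP[_ /eqP].
- by move: cT stepB mT; clear; lia.
- by move: cQ stepA qQ nq nm; clear; lia.
rewrite !inE => /andP[/eqP sa aT] /andP[bQ bi] Xab Yab.
have aF : a \notin F by apply/negP=> /tFT; rewrite aT.
have bF : b \notin F by move: QF; rewrite disjoint_subset => /subsetP/(_ _ bQ); rewrite inE.
by have := noh _ _ (swp _ _ Xab Yab aF bF) bQ; rewrite permM tpermR aT.
Qed.

Variable D : nat.
Hypotheses (Xexp : expanding side n D X) (Yexp : expanding side n D Y).

Lemma expand_edge m q d g s F W Q i j :
  mixing (16 * m) q -> W \subset F -> W \subset sd (~~ j) ->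
  (forall x, x \in W -> side (s x) = i) -> Q \subset sd j -> [disjoint Q & F] ->
  q + d <= #|Q| -> 8 * #|F| <= 16 * m -> 18 * m <= g * D -> g * D * 2 <= n ->
  0 < g -> g * (n * e) <= (#|W| - g) * d ->
  exists z y t, [/\ z \in W, y \in Q, X z y, reach F s t & Y (s z) (t y)].
Proof.
move=> wl WF Wj Wi Qj QF qQ Fm mg gn g0 cnt.
pose f z := avail side X Y s F set0 Q [set: V] z.
have sumf : (#|W| - g) * d <= g * \sum_(z in W) #|f z|.
  apply: sum_card_lower => B BW cB.
  have sB : s @: B \subset sd i by apply: imset_sd => x /(subsetP BW)/Wi.
  have csB : #|s @: B| = g by rewrite card_imset ?cB //; apply: perm_inj.
  have cN := Yexp sB; rewrite csB in cN.
  pose T := nbr Y (s @: B) :\: s @: F.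
  have cT := leq_card_setD (nbr Y (s @: B)) (s @: F).
  have cF := leq_imset_card s F.
  rewrite leqNgt; apply/negP=> small.
  have cQ := leq_card_setD Q (\bigcup_(z in B) f z).
  have /hitsP[t [y [st]]] : hits F s T (Q :\: \bigcup_(z in B) f z).
    apply: (wl s F T _ (~~ i) j).
    - by apply: subset_trans (nbr_sd Ybip sB); apply: subsetDl.
    - by apply: subset_trans Qj; apply: subsetDl.
    - by apply: disjointWl QF; apply: subsetDl.
    - by move=> x xF; rewrite inE imset_f.
    - by have := cN gn; rewrite -/T in cT; lia.
    - by lia.
    - by [].
  rewrite inE => /andP[yN yQ].
  rewrite !inE => /andP[_ /existsP[_ /andP[/imsetP[z zB ->] Yzy]]].
  case/negP: yN; apply/bigcupP; exists z => //; apply: mem_avail0 st _ Yzy => //.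
  - by move: QF; rewrite disjoint_subset => /subsetP/(_ _ yQ); rewrite inE.
  - by rewrite (in_sd Qj yQ) (in_sd Wj (subsetP BW _ zB)); case: (j).
have [||z [y [zW /availP[yQ _ _ _ [t st tx]] Xzy]]] := XYjoint (s := s) (F := F)
    (W := W) (H := set0) (Q := Q) (P := setT) WF.
- by rewrite cards0.
- by rewrite -(leq_pmul2l g0); apply: leq_trans sumf.
by exists z, y, t; split=> //; have [|] := tx y; rewrite ?eqxx.
Qed.

(** Freeze the positions of exactly [m] persons of [T] and move friends around them. If half of them
    stand opposite to [Q], [expand_edge] lets one swap into [Q]; otherwise it lets one swap across
    to the side opposite to [Q], against the maximality of [phi]. *)
Lemma mixing_step m q d g : mixing (16 * m) q -> 18 * m <= g * D -> g * D * 2 <= n -> 0 < g ->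
  2 * g * (n * e) <= (m - 2 * g) * d -> q + d + 2 * m <= n -> mixing m (q + d).
Proof.
move=> wl mg gn g0 cnt qdn s F T1 Q i j Ti Qj QF sFT mT qQ Fm.
have [T TT1 cT] := subset_of_card mT.
have {}Ti : T \subset sd i by apply: subset_trans TT1 Ti.
apply: contraT => /hitsP noh0.
pose phi t := #|[set x | (side x == ~~ j) && (t x \in T)]|.
have [t st tmax] := reach_max X Y F s phi.
have tFT x : x \in F -> t x \notin T.
  by move=> xF; rewrite (reach_fix st xF); apply: contra (sFT _ xF) => /(subsetP TT1).
(* At most [m / 8 + m] positions are frozen, which [mixing (16 * m)] tolerates. *)
pose F' := F :|: [set x | t x \in T].
have cF' : #|F'| <= #|F| + m by rewrite -cT -(card_preim t T); apply: leq_card_setU.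
have FF' : F \subset F' by apply: subsetUl.
have c2 := card_sub_side side t j T.
have condW (W : {set V}) : m <= 2 * #|W| -> g * (n * e) <= (#|W| - g) * d.
  move=> mW; rewrite -(leq_pmul2l (isT : 0 < 2)) mulnA; apply: (leq_trans cnt).
  by rewrite mulnA leq_mul2r; apply/orP; right; lia.
have [le|lt] := leqP m (2 * #|[set x | (side x == ~~ j) && (t x \in T)]|).
  have [|||||||||||z [y [u [+ yQ Xzy tu Yzy]]]] :=
    @expand_edge m q d g t F' [set x | (side x == ~~ j) && (t x \in T)] Q i j wl.
  - by apply/subsetP=> x; rewrite !inE => /andP[_ ->]; rewrite orbT.
  - by apply/subsetP=> x; rewrite !inE => /andP[->].
  - by move=> x; rewrite inE => /andP[_ /(in_sd Ti)].
  - by [].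
  - rewrite disjoint_subset; apply/subsetP=> x xQ; rewrite !inE negb_or.
    move: QF; rewrite disjoint_subset => /subsetP/(_ _ xQ); rewrite inE => -> /=.
    apply/negP=> xT; apply: noh0; exists t, x; split=> //.
    exact: (subsetP TT1).
  - by [].
  - by lia.
  - by [].
  - by [].
  - by [].
  - exact: condW.
  rewrite inE => /andP[zj zT].
  have zF : z \notin F by apply/negP=> /tFT; rewrite zT.
  have yF : y \notin F by move: QF; rewrite disjoint_subset => /subsetP/(_ _ yQ); rewrite inE.
  have uz : u z = t z by apply: reach_fix tu _ _; rewrite !inE zT orbT.
  case: noh0; exists (tperm z y * u)%g, y; split=> //.
    apply: (reach_trans st); apply: reach_swap => //; last by rewrite uz.
    exact: reach_sub tu.
  by rewrite permM tpermR uz (subsetP TT1).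
have [|||||||||||z [y [u [+ yQ Xzy tu Yzy]]]] :=
  @expand_edge m q d g t F' [set x | (side x == j) && (t x \in T)]
  (sd (~~ j) :\: F') i (~~ j) wl.
- by apply/subsetP=> x; rewrite !inE => /andP[_ ->]; rewrite orbT.
- by apply/subsetP=> x; rewrite !inE negbK => /andP[->].
- by move=> x; rewrite inE => /andP[_ /(in_sd Ti)].
- exact: subsetDl.
- by rewrite disjoint_subset; apply/subsetP=> x; rewrite !inE => /andP[].
- by have := leq_card_setD (sd (~~ j)) F'; rewrite card_sd; lia.
- by lia.
- by [].
- by [].
- by [].
- by apply: condW; lia.
rewrite inE => /andP[/eqP zj zT].
have zF : z \notin F by apply/negP=> /tFT; rewrite zT.
move: yQ; rewrite inE => /andP[yF' yj]; rewrite in_sdE in yj.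
have yF : y \notin F by apply: contra yF'; apply: subsetP.
have uz : u z = t z by apply: reach_fix tu _ _; rewrite !inE zT orbT.
have tv : reach F t (tperm z y * u)%g.
  apply: reach_swap => //; last by rewrite uz.
  exact: reach_sub tu.
have := tmax _ tv; rewrite leqNgt => /negP; case; rewrite /phi.
apply: (@leq_trans #|y |: [set x | (side x == ~~ j) && (t x \in T)]|).
  rewrite cardsU1 inE (_ : t y \in T = false) ?andbF //.
  by apply/negP=> yT; case/negP: yF'; rewrite !inE yT orbT.
apply: subset_leq_card; apply/subsetP=> x; rewrite !inE permM.
case: eqP => [->|xy] /=; first by rewrite tpermR uz yj.
move=> /andP[xj xT]; rewrite xj tpermD //.
- by rewrite (reach_fix tu) // !inE xT orbT.
- by apply/eqP=> E; move: xj; rewrite -E zj; case: (j).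
- by rewrite eq_sym; apply/eqP.
Qed.

(** Each of the [J] steps divides the number of persons by 16 and adds [d] exceptional positions. *)
Lemma mixing_iter M J q d :
  (forall m, M <= m -> 16 * m <= M * 16 ^ J -> exists g, [/\ 18 * m <= g * D, g * D * 2 <= n,
     0 < g & 2 * g * (n * e) <= (m - 2 * g) * d]) ->
  q + J * d + 2 * (M * 16 ^ J) <= n ->
  mixing (M * 16 ^ J) q -> mixing M (q + J * d).
Proof.
elim: J q => [|J IHJ] q hg hq wl; first by rewrite mul0n addn0; rewrite expn0 muln1 in wl.
have E : 16 ^ J.+1 = 16 * 16 ^ J by rewrite expnS.
have J0 : 0 < 16 ^ J by rewrite expn_gt0.
rewrite mulSn addnA; apply: IHJ.
- by move=> m Mm mJ; apply: hg => //; rewrite E; nia.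
- by rewrite E in hq; nia.
have [||g [h1 h2 h3 h4]] := hg (M * 16 ^ J); try by rewrite ?E; nia.
by apply: mixing_step h1 h2 h3 h4 _; [rewrite mulnCA -E | rewrite E in hq; nia].
Qed.

Variables M q : nat.
Hypothesis wlM : mixing M q.
Hypotheses (qn : 4 * q <= n) (MD : 2 * M <= D) (Dn : D * 2 <= n).
Hypotheses (eM : 224 * e <= M) (e_ge8 : 8 <= e) (een : 2 * (e * e) <= n) (Mn : 16 * M <= n).

(** For each [z] take a largest set [G z] of X-neighbours that friends of its person can occupy at
    once. If all were smaller than [e], then with [G z] frozen as well, mixing lets one more friend
    reach at least half of the opposite side. By [XYjoint] one of these positions is an X-neighbour
    of some [z], and [G z] can be enlarged. *)
Lemma bring_friends s F W i j : W \subset F -> W \subset sd j ->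
  (forall x, x \in W -> side (s x) = i) -> 2 * e <= #|W| -> 16 * #|F| <= M ->
  exists z (A : {set V}) t, [/\ z \in W, #|A| = e, reach F s t &
    forall y, y \in A -> [/\ X z y, y \notin F & Y (s z) (t y)]].
Proof.
move=> WF Wj Wi cW cF.
have [W0 W0W cW0] := subset_of_card cW.
pose ok z (A : {set V}) := [exists t, reach F s t &&
  [forall y in A, [&& X z y, y \notin F & Y (s z) (t y)]]].
have okP z A : reflect (exists2 t, reach F s t & forall y, y \in A ->
    [/\ X z y, y \notin F & Y (s z) (t y)]) (ok z A).
  apply: (iffP existsP) => [[t /andP[st /forallP h]]|[t st h]]; exists t => //.
    by move=> y yA; apply/and3P; have /implyP := h y; apply.
  by rewrite st; apply/forallP => y; apply/implyP=> /h[-> -> ->].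
have ok0 z : ok z set0 by apply/okP; exists s => [|y]; rewrite ?reach_refl ?inE.
pose G z := [arg max_(A > set0 | ok z A) #|A|].
have okG z : ok z (G z) by rewrite /G; case: arg_maxnP.
have maxG z A : ok z A -> #|A| <= #|G z|.
  by rewrite /G; case: (arg_maxnP _ (ok0 z)) => B _; apply.
case: (boolP [exists z in W0, e <= #|G z|]) => [/existsP[z /andP[zW eG]]|].
  have [A AG cA] := subset_of_card eG; have /okP[t st h] := okG z.
  by exists z, A, t; split=> //; [apply: (subsetP W0W) | move=> y /(subsetP AG)/h].
rewrite negb_exists => /forallP Gsmall0.
have Gsmall z : z \in W0 -> #|G z| < e.
  by move=> zW; have := Gsmall0 z; rewrite zW /= -ltnNge.
(* The sets [G z] depend on the X-edges at frozen positions; this is why [joint] quantifies over all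
   [H] of at most [n] pairs. *)
pose H := \bigcup_(z in W0) [set (z, x) | x in G z].
have HP z x : ((z, x) \in H) = (z \in W0) && (x \in G z).
  apply/bigcupP/andP => [[z' z'W /imsetP[x' xG [-> ->]]] //|[zW xG]].
  by exists z => //; apply: imset_f.
have cH : #|H| <= n.
  apply: leq_trans (card_bigcup_leq _ _) _; apply: leq_trans een.
  rewrite mulnA -cW0 -sum_nat_const; apply: leq_sum => z zW.
  by apply: leq_trans (leq_imset_card _ _) _; apply: ltnW; apply: Gsmall.
pose f z := avail side X Y s F H [set: V] [set: V] z.
have big z : z \in W0 -> n <= 2 * #|f z|.
  move=> zW; have zWW := subsetP W0W _ zW.
  have /okP[t st h] := okG z; have Gs := Gsmall _ zW.
  pose F' := F :|: G z; pose T := nbr Y [set s z] :\: t @: F'.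
  have cF' : #|F'| <= #|F| + #|G z| := leq_card_setU _ _.
  have cN := card_nbr1 (s z) Dn Yexp.
  have cT := leq_card_setD (nbr Y [set s z]) (t @: F').
  have ctF := leq_imset_card t F'.
  pose Q := sd (~~ j) :\: F' :\: f z.
  have c1 := leq_card_setD (sd (~~ j)) F'; rewrite card_sd in c1.
  have c2 := leq_card_setD (sd (~~ j) :\: F') (f z); rewrite -/Q in c2.
  suff : #|Q| < q by lia.
  rewrite ltnNge; apply/negP=> qQ.
  have /hitsP[u [y [tu]]] : hits F' t T Q.
    apply: (wlM (i := ~~ i) (j := ~~ j)) => //.
    - by apply: subset_trans (subsetDl _ _) _; rewrite -(Wi z zWW); apply: nbr1_sd.
    - by apply: subset_trans (subsetDl _ _) (subsetDl _ _).
    - by rewrite disjoint_subset; apply/subsetP=> x; rewrite !inE => /and3P[_].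
    - by move=> x xF; rewrite inE imset_f.
    - by rewrite -/T in cT; lia.
    - by lia.
  rewrite !in_setD => /and3P[yf yF' yj] /andP[_]; rewrite in_nbr1 => Yzy.
  case/negP: yf; apply/availP; split.
  - exact: in_setT.
  - by apply: contra yF'; rewrite inE => ->.
  - by rewrite in_sdE in yj; rewrite (eqP yj) (in_sd Wj zWW); case: (j).
  - by rewrite HP negb_and; apply/orP; right; apply: contra yF'; rewrite inE orbC => ->.
  exists u; first by apply: (reach_trans st); apply: reach_sub tu; apply: subsetUl.
  move=> x; rewrite HP zW /= => /orP[/eqP->|xG]; split=> //; try exact: in_setT.
  by rewrite (reach_fix tu) ?inE ?xG ?orbT //; case: (h _ xG).
have [|z [y [zW /availP[_ yF _ yH [t st tx]] Xzy]]] := XYjoint (s := s) (F := F)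
  (W := W0) (H := H) (Q := setT) (P := setT) (subset_trans W0W WF) cH.
  have : 2 * e * n <= 2 * \sum_(z in W0) #|f z|.
    by rewrite big_distrr /= -cW0 -sum_nat_const; apply: leq_sum => z /big.
  by rewrite /f; nia.
have /okP oky : ok z (y |: G z).
  apply/okP; exists t => // x; rewrite !inE => /orP[/eqP->|xG].
    by have [|] := tx y; rewrite ?eqxx.
  have [|_ Yzx] := tx x; first by rewrite HP zW xG orbT.
  by have /okP[t' _ h] := okG z; have [] := h _ xG.
have := maxG z _ (introT (okP _ _) oky); rewrite cardsU1.
by move: yH; rewrite HP zW /= => ->; rewrite add1n ltnn.
Qed.

Definition spot (F : {set V}) s (w : V) : {set V} :=
  [set x | [exists t, reach F s t && (t x == w)]].

Lemma spotP F s w x : reflect (exists2 t, reach F s t & t x = w) (x \in spot F s w).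
Proof.
rewrite inE; apply: (iffP existsP) => [[t /andP[st /eqP]]|[t st <-]]; first by exists t.
by exists t; rewrite st eqxx.
Qed.

(** After [bring_friends], freeze the [e] friends on [A]. At least half of the positions [x] on the
    side of [z] are X-adjacent to some [y] in [A] and can receive a further friend of the person at
    [z], who then goes from [z] over [y] to [x] by two swaps. *)
Lemma spread s F W i j : W \subset F -> W \subset sd j ->
  (forall x, x \in W -> side (s x) = i) -> 2 * e <= #|W| -> 16 * #|F| <= M ->
  exists2 z, z \in W & n <= 2 * #|sd j :&: spot (F :\ z) s (s z)|.
Proof.
move=> WF Wj Wi cW cF.
have [z [A [t [zW cA st h]]]] := bring_friends WF Wj Wi cW cF.
exists z => //; set G := _ :&: _.
have zF := subsetP WF _ zW; have zj := in_sd Wj zW.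
have Aj : A \subset sd (~~ j).
  by apply/subsetP=> y /h[/Xbip Xzy _ _]; rewrite in_sdE Xzy zj.
pose F' := F :|: A; pose T := nbr Y [set s z] :\: t @: F'.
have cF' : #|F'| <= #|F| + #|A| := leq_card_setU _ _.
have cN := card_nbr1 (s z) Dn Yexp.
have cT := leq_card_setD (nbr Y [set s z]) (t @: F').
have ctF := leq_imset_card t F'.
pose B := [set y in sd j | ~~ [exists x in A, X x y]].
have cB : #|B| < e by apply: (card_nonadjacent Xedge Aj); rewrite ?negbK ?cA.
pose Q := sd j :\: F' :\: B :\: G.
have c1 := leq_card_setD (sd j) F'; rewrite card_sd in c1.
have c2 := leq_card_setD (sd j :\: F') B.
have c3 := leq_card_setD (sd j :\: F' :\: B) G; rewrite -/Q in c3.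
suff : #|Q| < q by lia.
rewrite ltnNge; apply/negP=> qQ.
have /hitsP[u [x [tu]]] : hits F' t T Q.
  apply: (wlM (i := ~~ i) (j := j)) => //.
  - by apply: subset_trans (subsetDl _ _) _; rewrite -(Wi z zW); apply: nbr1_sd.
  - by apply: subset_trans (subsetDl _ _) (subset_trans (subsetDl _ _) (subsetDl _ _)).
  - by rewrite disjoint_subset; apply/subsetP=> x; rewrite !inE => /and4P[_ _].
  - by move=> x xF; rewrite inE imset_f.
  - by rewrite -/T in cT; lia.
  - by lia.
rewrite !in_setD => /and4P[xG xB xF' xj] /andP[_]; rewrite in_nbr1 => Yzx.
have xF : x \notin F by apply: contra xF'; rewrite inE => ->.
have [y /andP[yA Xyx]] : exists y, (y \in A) && X y x.
  by move: xB; rewrite inE xj /= negbK => /existsP.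
have [Xzy yF Yzy] := h _ yA.
case/negP: xG; rewrite inE xj; apply/spotP.
have uz : u z = s z.
  by rewrite (reach_fix tu) ?(reach_fix st) // inE zF.
have uy : u y = t y by rewrite (reach_fix tu) // inE yA orbT.
have nzx : z != x by apply: contraNneq xF => <-.
have nyx : y != x by apply: contraNneq xF' => <-; rewrite inE yA orbT.
have su : reach (F :\ z) s u.
  apply: (reach_trans (reach_sub (subD1set _ _) st)).
  by apply: reach_sub tu; apply: subset_trans (subD1set _ _) (subsetUl _ _).
exists (tperm y x * (tperm z y * u))%g; last by rewrite !permM tpermR tpermR.
apply: reach_swap; first apply: reach_swap => //;
  rewrite ?inE ?eqxx ?(negbTE yF) ?(negbTE xF) ?andbF //.
  by rewrite uz uy.
by rewrite !permM tpermR tpermD // uz.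
Qed.

(** First make most persons on [S] come from the side opposite to [T]; then, with [S] frozen, bring
    most of [T] to the side opposite to [S]. By [spread], at least [e] persons of [T] can each roam
    over half of that side, and most persons on [S1] have a friend among them. So the X-edges at
    [S1] allow one of them to enter [S]. *)
Lemma meet_small s F (S0 T0 : {set V}) i j : S0 \subset sd j -> T0 \subset sd i ->
  [disjoint S0 & F] -> (forall x, x \in F -> s x \notin T0) -> 5 * e <= #|S0| ->
  5 * e <= #|T0| -> 16 * (#|F| + 10 * e) <= M -> hits F s T0 S0.
Proof.
move=> Sj0 Ti0 SF0 sFT0 cS0 cT0 cF; apply: contraT => /hitsP noh0.
have [S SS0 cS] := subset_of_card cS0; have [T TT0 cT] := subset_of_card cT0.
have {Sj0 cS0}Sj := subset_trans SS0 Sj0; have {Ti0 cT0}Ti := subset_trans TT0 Ti0.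
have SF := disjointP_in (disjointWl SS0 SF0).
have sFT x : x \in F -> s x \notin T by move=> xF; apply: contra (sFT0 _ xF) => /(subsetP TT0).
have noh t y : reach F s t -> y \in S -> t y \notin T.
  move=> st yS; apply/negP=> tT; apply: noh0; exists t, y; split=> //.
    exact: (subsetP SS0).
  exact: (subsetP TT0).
have ni : (i == ~~ i) = false by case: (i).
have [t1 st1 max1] := reach_max X Y F s (fun t => #|[set x in S | side (t x) == ~~ i]|).
pose S1 := [set x in S | side (t1 x) == ~~ i].
pose F1 := F :|: S.
have cF1 : #|F1| <= #|F| + #|S| := leq_card_setU _ _.
have FF1 : F \subset F1 := subsetUl _ _.
(* Among [2 * e] positions of [S] with persons of side [i], one could swap its person with a friend,
   who belongs to the side [~~ i]. *)
have cS1 : 3 * e <= #|S1|.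
  pose W := [set x in S | side (t1 x) == i].
  have eS : #|S| = #|W| + #|S1|.
    rewrite -(cardsID [set x | side (t1 x) == i] S); congr (_ + _);
      apply: eq_card => x; rewrite !inE //.
    by rewrite andbC; case: (side (t1 x)); case: (i).
  suff : #|W| < 2 * e by move: eS cS; clear; lia.
  rewrite ltnNge; apply/negP=> cW.
  have [|||||z [A [t [zW cA t1t h]]]] := @bring_friends t1 F1 W i j.
  - by apply/subsetP=> x; rewrite !inE => /andP[-> _]; rewrite orbT.
  - by apply/subsetP=> x; rewrite inE => /andP[/(subsetP Sj)].
  - by move=> x; rewrite inE => /andP[_ /eqP].
  - by [].
  - by move: cF cF1 cS; clear; lia.
  move: zW; rewrite inE => /andP[zS /eqP zi].
  have [y yA] : exists y, y \in A by apply/set0Pn; rewrite -card_gt0 cA.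
  have [Xzy yF1 Yzy] := h _ yA.
  have tz : t z = t1 z by rewrite (reach_fix t1t) // inE zS orbT.
  have t1v : reach F t1 (tperm z y * t)%g.
    apply: reach_swap (reach_sub FF1 t1t) Xzy _ (SF _ zS) _; first by rewrite tz.
    by apply: contra yF1; apply: subsetP.
  have := max1 _ t1v; rewrite leqNgt => /negP; case.
  apply: (@leq_trans #|z |: S1|); first by rewrite cardsU1 inE zS zi ni.
  apply: subset_leq_card; apply/subsetP=> x; rewrite !inE permM.
  case: eqP => [->|xz] /=.
    by rewrite tpermL zS (Ybip Yzy) zi eqxx.
  move=> /andP[xS xi]; rewrite xS tpermD ?(reach_fix t1t) ?inE ?xS ?orbT //.
    by rewrite eq_sym; apply/eqP.
  by apply: contraNneq yF1 => ->; rewrite inE xS orbT.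
have [t2 t12 max2] :=
  reach_max X Y F1 t1 (fun t => #|[set x | (side x == ~~ j) && (t x \in T)]|).
have st2 : reach F s t2 by apply: (reach_trans st1); apply: reach_sub t12.
have noh2 u y : reach F1 t2 u -> y \in S -> u y \notin T.
  by move=> t2u; apply: noh; apply: (reach_trans st2); apply: reach_sub t2u.
have F1T x : x \in F1 -> t2 x \notin T.
  rewrite inE => /orP[xF|]; first by rewrite (reach_fix st2) // sFT.
  by apply: noh2; apply: reach_refl.
have preT : #|[set x | t2 x \in T]| = 5 * e by rewrite card_preim.
have c2 := card_sub_side side t2 j T.
have cTj : #|[set x | (side x == j) && (t2 x \in T)]| < 2 * e.
  rewrite ltnNge; apply/negP=> cW.
  pose F2 := F1 :|: [set x | t2 x \in T].
  have cF2 : #|F2| <= #|F1| + _ := leq_card_setU _ _; rewrite preT in cF2.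
  have [|||||z [A [t [zW cA t2t h]]]] :=
    @bring_friends t2 F2 [set x | (side x == j) && (t2 x \in T)] i j.
  - by apply/subsetP=> x; rewrite !inE => /andP[_ ->]; rewrite orbT.
  - by apply/subsetP=> x; rewrite !inE => /andP[].
  - by move=> x; rewrite inE => /andP[_ /(in_sd Ti)].
  - by [].
  - by move: cF cF1 cS cF2; clear; lia.
  move: zW; rewrite inE => /andP[/eqP zj zT].
  have [y yA] : exists y, y \in A by apply/set0Pn; rewrite -card_gt0 cA.
  have [Xzy yF2 Yzy] := h _ yA.
  have tz : t z = t2 z by rewrite (reach_fix t2t) // !inE zT orbT.
  have zF1 : z \notin F1 by apply/negP=> /F1T; rewrite zT.
  have t2v : reach F1 t2 (tperm z y * t)%g.
    apply: reach_swap (reach_sub (subsetUl _ _) t2t) Xzy _ zF1 _; first by rewrite tz.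
    by apply: contra yF2 => yF1; rewrite in_setU yF1.
  have yj : side y = ~~ j by rewrite (Xbip Xzy) zj.
  have := max2 _ t2v; rewrite leqNgt => /negP; case.
  apply: (@leq_trans #|y |: [set x | (side x == ~~ j) && (t2 x \in T)]|).
    rewrite cardsU1 inE (_ : t2 y \in T = false) ?andbF //.
    by apply/negP=> yT; case/negP: yF2; rewrite !inE yT orbT.
  apply: subset_leq_card; apply/subsetP=> x; rewrite !inE permM.
  case: eqP => [->|xy] /=; first by rewrite tpermR tz zT yj eqxx.
  move=> /andP[xj xT]; rewrite xj tpermD ?(reach_fix t2t) ?inE ?xT ?orbT //.
    by apply/eqP=> E; move: xj; rewrite -E zj; case: (j).
  by rewrite eq_sym; apply/eqP.
pose good x := n <= 2 * #|sd (~~ j) :&: spot F1 t2 (t2 x)|.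
pose T1 := [set x | (side x == ~~ j) && (t2 x \in T)].
pose T2 := [set x in T1 | good x].
have cT2 : e <= #|t2 @: T2|.
  rewrite card_imset; last exact: perm_inj.
  (* With [2 * e] persons on [T1] lacking this freedom, [spread] would give a contradiction. *)
  pose Wb := [set x in T1 | ~~ good x].
  have eT : #|T1| = #|T2| + #|Wb|.
    rewrite -(cardsID [set x | good x] T1); congr (_ + _);
      apply: eq_card => x; rewrite !inE //.
    by rewrite andbC.
  suff : #|Wb| < 2 * e by move: eT c2 cTj cT; rewrite -/T1; clear; lia.
  rewrite ltnNge; apply/negP=> cW.
  have T1T : T1 \subset [set x | t2 x \in T] by apply/subsetP=> x; rewrite !inE => /andP[].
  have cWb : #|Wb| <= 5 * e.
    rewrite -preT; apply: leq_trans (subset_leq_card T1T).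
    by apply: subset_leq_card; apply/subsetP=> x; rewrite inE => /andP[].
  have cF2 : #|F1 :|: Wb| <= #|F1| + #|Wb| := leq_card_setU _ _.
  have [|||||z zW] := @spread t2 (F1 :|: Wb) Wb i (~~ j).
  - exact: subsetUr.
  - by apply/subsetP=> x; rewrite !inE => /andP[/andP[]].
  - by move=> x; rewrite !inE => /andP[/andP[_ /(in_sd Ti)]].
  - by [].
  - by move: cF cF1 cS cF2 cWb; clear; lia.
  move: zW; rewrite inE => /andP[]; rewrite inE => /andP[zj zT] /negP zb zg; apply: zb.
  apply: leq_trans zg _; rewrite leq_mul2l; apply: subset_leq_card; apply: setIS.
  apply/subsetP=> x /spotP[t t2t tx]; apply/spotP; exists t => //.
  apply: reach_sub t2t; apply/subsetP=> y yF; rewrite !inE; apply/andP; split.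
    by apply/eqP=> E; have := F1T _ yF; rewrite E zT.
  by move: yF; rewrite inE => /orP[] ->; rewrite ?orbT.
have t2S x : x \in S -> t2 x = t1 x by move=> xS; rewrite (reach_fix t12) // inE xS orbT.
have sdT2 : t2 @: T2 \subset sd i.
  by apply: imset_sd => x; rewrite !inE => /andP[/andP[_ /(in_sd Ti)]].
have sdS1 : t2 @: S1 \subset sd (~~ i).
  by apply: imset_sd => x; rewrite inE => /andP[/t2S-> /eqP].
have cB := card_nonadjacent Yedge sdT2 sdS1 cT2.
set B := [set y in _ | _] in cB.
have S1F1 : S1 \subset F1.
  by apply/subsetP=> x; rewrite !inE => /andP[-> _]; rewrite orbT.
pose f z := avail side X Y t2 F1 set0 (sd (~~ j)) (t2 @: T2) z.
pose S2 := S1 :\: [set x | t2 x \in B].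
have cS2 : 2 * e <= #|S2|.
  have := leq_card_setD S1 [set x | t2 x \in B]; rewrite card_preim -/S2.
  by move: cS1 cB; clear; lia.
(* The person at [z] has a friend on [T2], and this friend alone reaches half of the side opposite
   to [S]. *)
have big z : z \in S2 -> n <= 2 * #|f z|.
  rewrite in_setD => /andP[zB zS1].
  have zj : side z = j by move: zS1; rewrite inE => /andP[/(in_sd Sj)].
  move: zB; rewrite !inE imset_f //= negbK => /existsP[w /andP[/imsetP[x xT2 ->] Yxz]].
  have /andP[xT1 xg] : (x \in T1) && good x by move: xT2; rewrite inE.
  apply: leq_trans xg _; rewrite leq_mul2l; apply: subset_leq_card.
  apply/subsetP=> y; rewrite in_setI => /andP[yj /spotP[u t2u uy]].
  apply: (mem_avail0 _ _ _ t2u) => //.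
  - apply/negP=> yF1; move: uy; rewrite (reach_fix t2u) // => /perm_inj E.
    by have := F1T _ yF1; rewrite E; move: xT1; rewrite inE => /andP[_ ->].
  - by rewrite in_sdE in yj; rewrite (eqP yj) zj; case: (j).
  - by rewrite uy imset_f.
  - by rewrite uy Ysym.
have [||z [y [zS /availP[yQ yF1 _ _ [t t2t tx]] Xzy]]] := XYjoint (s := t2) (F := F1)
    (W := S1) (H := set0) (Q := sd (~~ j)) (P := t2 @: T2) S1F1.
- by rewrite cards0.
- have le1 : \sum_(z in S2) #|f z| <= \sum_(z in S1) #|f z|.
    by rewrite [X in _ <= X](big_setID [set x | t2 x \in B]) leq_addl.
  have : #|S2| * n <= 2 * \sum_(z in S2) #|f z|.
    by rewrite big_distrr /= -sum_nat_const; apply: leq_sum => z /big.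
  move: le1; rewrite /f; move: #|S2| cS2 => c cS2.
  move: (\sum_(z in S2) _) (\sum_(z in S1) _) => a b ab ca.
  have : 2 * e * n <= c * n by rewrite leq_mul2r cS2 orbT.
  by move: ab ca; clear; lia.
have [|tyT Yzy] := tx y; first by rewrite eqxx.
have zS0 : z \in S by move: zS; rewrite inE => /andP[].
have tz : t z = t2 z by rewrite (reach_fix t2t) // inE zS0 orbT.
have tyT0 : t y \in T.
  by move: tyT => /imsetP[x + ->]; rewrite !inE => /andP[/andP[]].
have sv : reach F s (tperm z y * t)%g.
  apply: (reach_trans st2); apply: reach_swap => //.
  - exact: reach_sub t2t.
  - by rewrite tz.
  - exact: SF.
  - by apply: contra yF1; apply: subsetP.
by have := noh _ _ sv zS0; rewrite permM tpermL tyT0.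
Qed.

Lemma half_nbr s F z : z \notin F -> #|F| <= 3 * e ->
  exists2 A : {set V}, A \subset nbr X [set z] & e <= #|A| /\
    forall x, x \in A -> exists2 u, reach F s u & u x = s z.
Proof.
move=> zF cF; pose A := nbr X [set z] :&: spot F s (s z).
exists A; first exact: subsetIl.
split; last by move=> x; rewrite in_setI => /andP[_ /spotP].
pose F' := z |: F.
have cF' : #|F'| <= #|F|.+1 by rewrite cardsU1; case: (_ \notin _).
pose S := nbr X [set z] :\: F :\: A; pose T := nbr Y [set s z] :\: s @: F'.
have d1 := card_nbr1 z Dn Xexp; have d2 := card_nbr1 (s z) Dn Yexp.
have c1 := leq_card_setD (nbr X [set z]) F.
have c2 := leq_card_setD (nbr X [set z] :\: F) A; rewrite -/S in c2.
have c3 := leq_card_setD (nbr Y [set s z]) (s @: F'); rewrite -/T in c3.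
have c4 := leq_imset_card s F'.
rewrite leqNgt; apply/negP=> cA.
have /hitsP[u [y [su]]] : hits F' s T S.
  apply: (meet_small (i := ~~ side (s z)) (j := ~~ side z)).
  - apply: subset_trans (subsetDl _ _) (subset_trans (subsetDl _ _) _).
    exact: nbr1_sd.
  - by apply: subset_trans (subsetDl _ _) _; apply: nbr1_sd.
  - rewrite disjoint_subset; apply/subsetP=> x; rewrite !in_setD in_nbr1 !inE.
    case/and3P=> _ xF Xzx; rewrite negb_or xF andbT.
    by apply/eqP=> E; move: (Xbip Xzx); rewrite E; case: (side z).
  - by move=> x xF; rewrite in_setD imset_f.
  - by move: c1 c2 d1 cA cF MD eM; clear; lia.
  - by move: c3 c4 cF' d2 cF MD eM e_gt0; clear; lia.
  - by move: cF' cF eM e_ge8; clear; lia.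
rewrite !in_setD !in_nbr1 => /and3P[yA yF Xzy] /andP[_ Yzy].
have uz : u z = s z by rewrite (reach_fix su) // !inE eqxx.
case/negP: yA; rewrite in_setI in_nbr1 Xzy; apply/spotP.
exists (tperm z y * u)%g; last by rewrite permM tpermR.
by apply: reach_swap (reach_sub (subsetUr _ _) su) Xzy _ zF yF; rewrite uz.
Qed.

(** The same swap seen from the position [z], which receives the friend. *)
Lemma half_nbr_dual s F z : z \notin F -> #|F| <= 3 * e ->
  exists2 A : {set V}, A \subset nbr Y [set s z] & e <= #|A| /\
    forall w, w \in A -> exists2 u, reach F s u & u z = w.
Proof.
move=> zF cF; pose A := nbr Y [set s z] :&: [set w | z \in spot F s w].
exists A; first exact: subsetIl.
split; last by move=> x; rewrite in_setI => /andP[_]; rewrite inE => /spotP.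
pose F' := z |: F.
have cF' : #|F'| <= #|F|.+1 by rewrite cardsU1; case: (_ \notin _).
pose S := nbr X [set z] :\: F; pose T := nbr Y [set s z] :\: s @: F' :\: A.
have d1 := card_nbr1 z Dn Xexp; have d2 := card_nbr1 (s z) Dn Yexp.
have c1 := leq_card_setD (nbr X [set z]) F; rewrite -/S in c1.
have c2 := leq_card_setD (nbr Y [set s z]) (s @: F').
have c3 := leq_card_setD (nbr Y [set s z] :\: s @: F') A; rewrite -/T in c3.
have c4 := leq_imset_card s F'.
rewrite leqNgt; apply/negP=> cA.
have /hitsP[u [y [su]]] : hits F' s T S.
  apply: (meet_small (i := ~~ side (s z)) (j := ~~ side z)).
  - by apply: subset_trans (subsetDl _ _) _; apply: nbr1_sd.
  - apply: subset_trans (subsetDl _ _) (subset_trans (subsetDl _ _) _).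
    exact: nbr1_sd.
  - rewrite disjoint_subset; apply/subsetP=> x; rewrite !in_setD in_nbr1 !inE.
    case/andP=> xF Xzx; rewrite negb_or xF andbT.
    by apply/eqP=> E; move: (Xbip Xzx); rewrite E; case: (side z).
  - by move=> x xF; rewrite !in_setD imset_f // andbF.
  - by move: c1 d1 cF MD eM; clear; lia.
  - by move: c2 c3 c4 cF' d2 cF MD eM e_gt0 cA; clear; lia.
  - by move: cF' cF eM e_ge8; clear; lia.
rewrite !in_setD !in_nbr1 => /andP[yF Xzy] /and3P[yA _ Yzy].
have uz : u z = s z by rewrite (reach_fix su) // !inE eqxx.
case/negP: yA; rewrite in_setI in_nbr1 Yzy inE; apply/spotP.
exists (tperm z y * u)%g; last by rewrite permM tpermL.
by apply: reach_swap (reach_sub (subsetUr _ _) su) Xzy _ zF yF; rewrite uz.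
Qed.

(** Maximize the number of friends of [w] next to [a]. Fewer than [2 * e] of them would leave room
    for [meet_small] to bring one more while they are frozen. *)
Lemma place_friends s F a w : #|F| <= 8 ->
  exists2 t, reach F s t & exists2 S0 : {set V}, #|S0| = 2 * e &
    forall x, x \in S0 -> [/\ X a x, x \notin F & Y w (t x)].
Proof.
move=> cF; pose S := nbr X [set a] :\: F; pose T := nbr Y [set w] :\: s @: F.
have d1 := card_nbr1 a Dn Xexp; have d2 := card_nbr1 w Dn Yexp.
have c1 := leq_card_setD (nbr X [set a]) F; rewrite -/S in c1.
have c2 := leq_card_setD (nbr Y [set w]) (s @: F); rewrite -/T in c2.
have c3 := leq_imset_card s F.
have [t st tmax] := reach_max X Y F s (fun t => #|[set x in S | t x \in T]|).
exists t => //; pose B := [set x in S | t x \in T].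
suff /subset_of_card[S0 S0B cS0] : 2 * e <= #|B|.
  exists S0 => // x /(subsetP S0B); rewrite inE => /andP[].
  by rewrite !in_setD !in_nbr1 => /andP[xF Xax] /andP[_ Yw].
rewrite leqNgt; apply/negP=> cB.
pose F' := F :|: B.
have cF' : #|F'| <= #|F| + #|B| := leq_card_setU _ _.
have c4 := leq_card_setD S B; have c5 := leq_card_setD T (t @: B).
have c6 := leq_imset_card t B.
have /hitsP[u [y [tu]]] : hits F' t (T :\: t @: B) (S :\: B).
  apply: (meet_small (i := ~~ side w) (j := ~~ side a)).
  - apply: subset_trans (subsetDl _ _) (subset_trans (subsetDl _ _) _).
    exact: nbr1_sd.
  - apply: subset_trans (subsetDl _ _) (subset_trans (subsetDl _ _) _).
    exact: nbr1_sd.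
  - rewrite disjoint_subset; apply/subsetP=> x; rewrite !in_setD => /and3P[xB xF _].
    by rewrite inE in_setU negb_or xB xF.
  - move=> x; rewrite in_setU => /orP[xF|xB].
      by rewrite !in_setD (reach_fix st) // (imset_f s) // andbF.
    by rewrite in_setD imset_f.
  - by move: c1 c4 d1 cF MD eM e_ge8 cB; clear; lia.
  - by move: c2 c3 c5 c6 d2 cF MD eM e_ge8 cB; clear; lia.
  - by move: cF' cF eM e_ge8 cB; clear; lia.
rewrite in_setD => /andP[yB yS]; rewrite in_setD => /andP[_ yT].
have := tmax u (reach_sub (subsetUl _ _) tu); rewrite leqNgt => /negP; case.
apply: (@leq_trans #|y |: B|); first by rewrite cardsU1 yB.
apply: subset_leq_card; apply/subsetP=> x; rewrite in_setU1 inE.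
case: eqP => [-> _|_ /= xB]; first by rewrite yS yT.
by rewrite (reach_fix tu) ?in_setU ?xB ?orbT //; move: xB; rewrite inE.
Qed.

(** Surround [a] with friends of [w] on a set [S0] and freeze it. First [w] is led to a position
    [x0] of [S0]; then a person [v0] that has a Y-neighbour [v1] on [S0] is led to [a]. Swapping
    [v0] with [v1], and then [v1] with [w], puts [w] on [a]. *)
Lemma route s F a w : a \notin F -> (forall x, x \in F -> s x <> w) -> #|F| <= 8 ->
  exists2 t, reach F s t & t a = w.
Proof.
move=> aF sFw cF.
have [t1 st1 [S0 cS0 hS0]] := place_friends s a w cF.
pose F1 := F :|: S0.
have cF1 : #|F1| <= 3 * e.
  by have : #|F1| <= #|F| + #|S0| := leq_card_setU _ _; move: cF cS0 e_ge8; clear; lia.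
have FF1 : F \subset F1 := subsetUl _ _.
have S0a : S0 \subset sd (~~ side a).
  by apply/subsetP=> x /hS0[/Xbip Xax _ _]; rewrite in_sdE Xax.
have notF1 t : reach F1 t1 t -> forall x, t x = w -> x \notin F1.
  move=> t1t x tx; apply/negP=> xF1; move: tx; rewrite (reach_fix t1t) //.
  move: xF1; rewrite in_setU => /orP[xF|/hS0[_ _ Yw] E].
    by rewrite (reach_fix st1) //; apply: sFw.
  by move: (Ybip Yw); rewrite E; case: (side w).
(* Bring [w] to the side opposite to [a]: the X-neighbours accessible from there lie on the side of
   [a], and an X-edge joins one of them to [S0]. *)
have [t2 t12 [z t2z zs]] :
    exists2 t2, reach F1 t1 t2 & exists2 z, t2 z = w & side z = ~~ side a.
  pose z0 := (t1^-1)%g w.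
  have t1z0 : t1 z0 = w by rewrite /z0 permKV.
  have z0F1 : z0 \notin F1 by apply: notF1 t1z0; apply: reach_refl.
  have [E|NE] := eqVneq (side z0) (side a); last first.
    exists t1; first exact: reach_refl.
    by exists z0 => //; move: NE; case: (side z0); case: (side a).
  have [A Az [cA hA]] := half_nbr t1 z0F1 cF1.
  have [x xA] : exists x, x \in A by apply/set0Pn; rewrite -card_gt0; apply: leq_trans cA.
  have [u t1u ux] := hA _ xA; exists u => //; exists x; first by rewrite ux.
  by move: (subsetP Az _ xA); rewrite in_nbr1 => /Xbip->; rewrite E.
have zF1 : z \notin F1 by apply: notF1 t2z.
have [A Az [cA hA]] := half_nbr t2 zF1 cF1.
have As : A \subset sd (side a).
  by apply: subset_trans Az _; rewrite -[side a]negbK -zs; apply: nbr1_sd.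
have [x [x0 [xA x0S Xx]]] : exists x y, [/\ x \in A, y \in S0 & X x y].
  by apply: (Xedge As S0a) => //; rewrite cS0; move: e_gt0; clear; lia.
have [u t2u ux] := hA _ xA; rewrite t2z in ux.
have t1u := reach_trans t12 t2u.
have [Xax0 x0F Yw0] := hS0 _ x0S.
have ux0 : u x0 = t1 x0 by rewrite (reach_fix t1u) // in_setU x0S orbT.
have xF1 : x \notin F1 := notF1 _ t1u _ ux.
pose t3 := (tperm x0 x * u)%g.
have st3 : reach F s t3.
  apply: reach_swap (reach_trans st1 (reach_sub FF1 t1u)) _ _ x0F _; first by rewrite Xsym.
    by rewrite ux0 ux Ysym.
  by apply: contra xF1; apply: subsetP.
have t3x0 : t3 x0 = w by rewrite /t3 permM tpermL.
have t3S y : y \in S0 -> y != x0 -> t3 y = t1 y.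
  move=> yS yx0; rewrite /t3 permM tpermD 1?eq_sym //.
    by rewrite (reach_fix t1u) // in_setU yS orbT.
  by apply: contraNneq xF1 => <-; rewrite in_setU yS orbT.
have aF1 : a \notin F1.
  rewrite in_setU negb_or aF; apply/negP=> /(in_sd S0a).
  by case: (side a).
(* Bring to [a] a person from the side opposite to [w]: its Y-neighbours are then on the side of
   [w], opposite to the friends on [S0]. *)
have [t4 t34 t4a] : exists2 t4, reach F1 t3 t4 & side (t4 a) = ~~ side w.
  have [E|NE] := eqVneq (side (t3 a)) (side w); last first.
    exists t3; first exact: reach_refl.
    by move: NE; case: (side (t3 a)); case: (side w).
  have [A' Az' [cA' hA']] := half_nbr_dual t3 aF1 cF1.
  have [y yA] : exists x, x \in A' by apply/set0Pn; rewrite -card_gt0; apply: leq_trans cA'.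
  have [v t3v va] := hA' _ yA; exists v => //; rewrite va.
  by move: (subsetP Az' _ yA); rewrite in_nbr1 => /Ybip->; rewrite E.
have [A' Az' [cA' hA']] := half_nbr_dual t4 aF1 cF1.
have As' : A' \subset sd (side w).
  by apply: subset_trans Az' _; rewrite -[side w]negbK -t4a; apply: nbr1_sd.
have Bs : t1 @: (S0 :\ x0) \subset sd (~~ side w).
  by apply: imset_sd => y; rewrite !inE => /andP[_ /hS0[_ _ /Ybip]].
have cB : e <= #|t1 @: (S0 :\ x0)|.
  rewrite card_imset; last exact: perm_inj.
  by have := cardsD1 x0 S0; rewrite x0S add1n cS0; move: e_ge8; clear; lia.
have [v0 [v1 [vA /imsetP[x1 + Ev1] Yv]]] := Yedge As' Bs cA' cB.
rewrite !inE => /andP[x10 x1S].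
have [v t4v va] := hA' _ vA; have t3v := reach_trans t34 t4v.
have [Xax1 x1F Yw1] := hS0 _ x1S.
have vx1 : v x1 = t1 x1.
  by rewrite (reach_fix t3v) ?in_setU ?x1S ?orbT // t3S.
have vx0 : v x0 = w by rewrite (reach_fix t3v) // in_setU x0S orbT.
have na y : y \in S0 -> y != a.
  by move=> yS; apply: contraNneq aF1 => <-; rewrite in_setU yS orbT.
exists (tperm x0 a * (tperm x1 a * v))%g; last first.
  by rewrite !permM tpermR tpermD // eq_sym na.
apply: reach_swap; rewrite 1?Xsym //.
  apply: reach_swap (reach_trans st3 (reach_sub FF1 t3v)) _ _ x1F aF; first by rewrite Xsym.
  by rewrite vx1 va -Ev1 Ysym.
by rewrite !permM tpermR tpermD ?vx0 ?vx1 //; rewrite eq_sym na.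
Qed.

End Deterministic.

(** * Words in transpositions, compared on indices *)

Section TranspositionWords.
Variables (V : finType) (m : nat) (f : nat -> V).
Hypothesis f_inj : forall i j, i < m -> j < m -> f i = f j -> i = j.

Definition swap_nat (ij : nat * nat) (k : nat) : nat :=
  if k == ij.1 then ij.2 else if k == ij.2 then ij.1 else k.

Definition word_ok (l : seq (nat * nat)) := all (fun ij => (ij.1 < m) && (ij.2 < m)) l.

Definition word_perm (l : seq (nat * nat)) : {perm V} :=
  foldr (fun ij acc => tperm (f ij.1) (f ij.2) * acc)%g 1%g l.

Lemma tperm_swap_nat i j k : i < m -> j < m -> k < m ->
  tperm (f i) (f j) (f k) = f (swap_nat (i, j) k).
Proof.
move=> im jm km; rewrite /swap_nat /=; case: eqP => [->|ki]; first by rewrite tpermL.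
case: eqP => [->|kj]; first by rewrite tpermR.
by rewrite tpermD //; apply/eqP=> /f_inj E; [apply: ki|apply: kj]; rewrite E.
Qed.

Lemma word_permE l k : word_ok l -> k < m ->
  word_perm l (f k) = f (foldl (fun k ij => swap_nat ij k) k l).
Proof.
elim: l k => [|[i j] l IHl] k /=; first by rewrite perm1.
case/andP=> /andP[im jm] lm km; rewrite permM tperm_swap_nat // IHl //.
by rewrite /swap_nat /=; case: ifP => // _; case: ifP.
Qed.

Lemma word_perm_out l x : word_ok l -> (forall k, k < m -> x != f k) -> word_perm l x = x.
Proof.
move=> + xf; elim: l => [|[i j] l IHl] /=; first by rewrite perm1.
case/andP=> /andP[im jm] lm; rewrite permM tpermD ?IHl //; rewrite eq_sym; exact: xf.
Qed.

(** Both words fix every point other than [f 0, ..., f (m - 1)], and on these they act through the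
    indices; so an identity between permutations of [V] is decided by evaluation. *)
Lemma word_perm_eq l1 l2 : word_ok l1 -> word_ok l2 ->
  all (fun k => foldl (fun k ij => swap_nat ij k) k l1 ==
                foldl (fun k ij => swap_nat ij k) k l2) (iota 0 m) ->
  word_perm l1 = word_perm l2.
Proof.
move=> ok1 ok2 /allP E; apply/permP=> x.
case: (boolP [exists k : 'I_m, x == f k]) => [/existsP[k /eqP->]|].
  by rewrite !word_permE // (eqP (E k _)) // mem_iota /=.
rewrite negb_exists => /forallP h.
by rewrite !word_perm_out // => k km; apply: (h (Ordinal km)).
Qed.

End TranspositionWords.

(* The graph made of three internally disjoint paths of length 3 from 0 to 1. *)
Definition theta_edges : seq (nat * nat) :=
  [:: (0, 2); (2, 3); (3, 1); (0, 4); (4, 5); (5, 1); (0, 6); (6, 7); (7, 1)].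

Definition theta_rel : rel nat := fun i j =>
  ((i, j) \in theta_edges) || ((j, i) \in theta_edges).

Lemma theta_rel_irr : irreflexive theta_rel.
Proof. by case=> [|[|[|[|[|[|[|[|i]]]]]]]]. Qed.

(* Found by breadth-first search: walking the empty square of a sliding puzzle
   along this path exchanges it with the token at 1 and restores all others. *)
Definition theta_walk : seq nat :=
  [:: 2; 3; 1; 5; 4; 0; 6; 7; 1; 5; 4; 0; 6; 7; 1; 5; 4; 0; 2; 3; 1; 5; 4; 0; 6; 7;
      1; 5; 4; 0; 6; 7; 1; 5; 4; 0; 2; 3; 1].

(** * Exchanging two adjacent persons along a theta graph *)

Section Exchange.
Variables (V : finType) (X Y : rel V).
Hypotheses (Xsym : symmetric X) (Ysym : symmetric Y).
Implicit Types (s t : {perm V}) (F : {set V}).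

(** The bound 8 is the number of vertices of the theta graph, which are filled one after the
    other. *)
Definition routable := forall s F a w, a \notin F -> (forall x, x \in F -> s x <> w) ->
  #|F| <= 8 -> exists2 t, reach X Y F s t & t a = w.

Definition theta_at a b := exists f : nat -> V,
  [/\ f 0 = a, f 1 = b, forall i j, i < 8 -> j < 8 -> f i = f j -> i = j &
      forall i j, (i, j) \in theta_edges -> X (f i) (f j)].

Lemma route_seq (l : seq (V * V)) s F : routable ->
  uniq (unzip1 l) -> uniq (unzip2 l) -> (forall x, x \in F -> x \notin unzip1 l) ->
  (forall x, x \in F -> s x \notin unzip2 l) -> #|F| + size l <= 8 ->
  exists2 t, reach X Y F s t & forall xw, xw \in l -> t xw.1 = xw.2.
Proof.
move=> rt; elim: l s F => [|[x w] l IHl] s F /=; first by exists s; rewrite ?reach_refl.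
case/andP=> xl ul /andP[wl ul'] Fx Fw cF.
have xF : x \notin F by apply/negP=> /Fx; rewrite inE eqxx.
have [|||t st tx] := rt s F x w.
- by [].
- by move=> y /Fw; rewrite inE negb_or => /andP[/eqP].
- by lia.
have [|||||u tu hu] := IHl t (x |: F).
- by [].
- by [].
- move=> y; rewrite !inE => /orP[/eqP->|/Fx] //.
  by rewrite inE negb_or => /andP[].
- move=> y; rewrite !inE => /orP[/eqP->|yF]; first by rewrite tx.
  by rewrite (reach_fix st) //; move: (Fw _ yF); rewrite inE negb_or => /andP[].
- by rewrite cardsU1 xF; lia.
exists u; first by apply: (reach_trans st); apply: reach_sub tu; apply: subsetUr.
move=> [y v]; rewrite inE => /orP[/eqP[-> ->]|/hu] //=.
by rewrite (reach_fix tu) // !inE eqxx.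
Qed.

Lemma reach_conj F s t a b : a \in F -> b \in F -> reach X Y F s t ->
  reach X Y F (tperm a b * s)%g (tperm a b * t)%g.
Proof.
move=> aF bF; move: t; apply: reach_ind => [|t c d _ IH Xcd Ycd cF dF].
  exact: reach_refl.
have nF x y : x \in F -> y \notin F -> x != y by move=> xF; apply: contraNneq => <-.
have -> : (tperm a b * (tperm c d * t) = tperm c d * (tperm a b * t))%g.
  rewrite !mulgA; congr (_ * _)%g; apply/permP=> x; rewrite !permM.
  have [->|xc] := eqVneq x c; first by rewrite [X in tperm _ _ X]tpermD ?tpermL ?tpermD ?nF.
  have [->|xd] := eqVneq x d; first by rewrite [X in tperm _ _ X]tpermD ?tpermR ?tpermD ?nF.
  rewrite [tperm c d x]tpermD 1?eq_sym // tpermD //.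
    by case: tpermP => *; rewrite eq_sym //; apply: nF.
  by case: tpermP => *; rewrite eq_sym //; apply: nF.
by apply: reach_swap => //; rewrite !permM !tpermD ?nF.
Qed.

(** The person at [f i] plays the empty square: all others on the theta graph are its friends, so it
    may swap with any of them along an edge. Later swaps multiply on the left, hence the [rev]. *)
Lemma reach_walk (f : nat -> V) (p : seq nat) i s :
  (forall j k, j < 8 -> k < 8 -> f j = f k -> j = k) ->
  (forall j k, (j, k) \in theta_edges -> X (f j) (f k)) ->
  i < 8 -> path theta_rel i p -> all (fun j => j < 8) p ->
  (forall k, k < 8 -> k != i -> Y (s (f i)) (s (f k))) ->
  reach X Y set0 s (word_perm f (rev (pairmap pair i p)) * s)%g.
Proof.
move=> fi fX; elim: p i s => [|j p IHp] i s im /=; first by rewrite mul1g reach_refl.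
case/andP=> ij pp /andP[jm pm] hY.
have nij : i != j by apply: contraTneq ij => ->; rewrite theta_rel_irr.
have Xij : X (f i) (f j) by case/orP: ij => /fX //; rewrite Xsym.
have st : reach X Y set0 s (tperm (f i) (f j) * s)%g.
  by apply: reach_swap; rewrite ?inE ?reach_refl ?hY // eq_sym.
apply: (reach_trans st); rewrite rev_cons.
have -> : (word_perm f (rcons (rev (pairmap pair j p)) (i, j)) * s =
  word_perm f (rev (pairmap pair j p)) * (tperm (f i) (f j) * s))%g.
  rewrite mulgA; congr (_ * _)%g; elim: (rev _) => [|x l IHl] /=.
    by rewrite mulg1 mul1g.
  by rewrite IHl mulgA.
apply: IHp => // k km kj; rewrite !permM tpermR (tperm_swap_nat fi) //.
rewrite /swap_nat /=; case: eqP => [_|ki]; first by apply: hY; rewrite // eq_sym.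
by rewrite (negbTE kj); apply: hY => //; apply/eqP.
Qed.

(** Fill the six inner vertices with friends of the person at [a], run the walk, and undo the
    filling by [reach_conj]. *)
Lemma exchange s a b : irreflexive Y -> routable -> theta_at a b -> Y (s a) (s b) ->
  7 <= #|nbr Y [set s a]| -> reach X Y set0 s (tperm a b * s)%g.
Proof.
move=> Yirr rt [f [f0 f1 fi fX]] Yab cN.
have nab : a != b by apply: contraTneq Yab => ->; rewrite Yirr.
have : 6 <= #|nbr Y [set s a] :\ s b|.
  by have := cardsD1 (s b) (nbr Y [set s a]); case: (_ \in _); lia.
case/subset_of_card=> L LN cL.
have LY w : w \in L -> w != s b /\ Y (s a) w.
  move=> /(subsetP LN); rewrite in_setD1 inE => /andP[-> /existsP[x /andP[]]].
  by rewrite inE => /eqP->.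
pose l := zip [seq f k | k <- iota 2 6] (enum L).
have sL : size (enum L) = 6 by rewrite -cardE.
have l1 : unzip1 l = [seq f k | k <- iota 2 6] by rewrite unzip1_zip // sL.
have l2 : unzip2 l = enum L by rewrite unzip2_zip // sL.
have [|||||t st tl] := @route_seq l s [set a; b] rt.
- rewrite l1 map_inj_in_uniq ?iota_uniq // => i j; rewrite !mem_iota => im jm.
  by apply: fi; lia.
- by rewrite l2 enum_uniq.
- move=> x; rewrite l1 in_set2 => /orP[/eqP->|/eqP->]; apply/mapP => -[k].
    by rewrite mem_iota -f0 => km /fi; lia.
  by rewrite mem_iota -f1 => km /fi; lia.
- move=> x; rewrite l2 mem_enum in_set2 => /orP[/eqP->|/eqP->]; apply/negP=> /LY[].
    by rewrite Yirr.
  by rewrite eqxx.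
- by rewrite cards2 nab size_zip size_map size_iota sL.
have ta : t a = s a by rewrite (reach_fix st) // !inE eqxx.
have tb : t b = s b by rewrite (reach_fix st) // !inE eqxx orbT.
have tY k : k < 8 -> k != 0 -> Y (t (f 0)) (t (f k)).
  case: k => [|[|k]] // km _; first by rewrite f0 f1 ta tb.
  rewrite f0 ta; have kl : (f k.+2, nth (s a) (enum L) k) \in l.
    have -> : (f k.+2, nth (s a) (enum L) k) = nth (f 0, s a) l k.
      rewrite nth_zip ?size_map ?size_iota ?sL //; congr (_, _).
      by rewrite (nth_map 0) ?size_iota // nth_iota.
    by apply: mem_nth; rewrite size_zip size_map size_iota sL.
  rewrite (tl _ kl) /=; have /LY[] // : nth (s a) (enum L) k \in L.
  by rewrite -mem_enum mem_nth // sL.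
have := @reach_walk f theta_walk 0 t fi fX isT isT isT tY.
have -> : word_perm f (rev (pairmap pair 0 theta_walk)) = tperm a b.
  rewrite (_ : tperm a b = word_perm f [:: (0, 1)]); last by rewrite /= f0 f1 mulg1.
  by apply: (word_perm_eq fi); vm_compute.
move=> tw; apply: (reach_trans (reach_sub (sub0set _) st)); apply: (reach_trans tw).
apply: (reach_sub (sub0set [set a; b])).
by apply: reach_conj; rewrite ?inE ?eqxx ?orbT // reach_sym.
Qed.

End Exchange.

(** * Monotonicity, and duality between positions and persons *)

Lemma reach_mono (V : finType) (X X' Y : rel V) F s t : subrel X X' ->
  reach X Y F s t -> reach X' Y F s t.
Proof.
move=> sXX; move: t; apply: reach_ind => [|t a b _ st Xab Yab aF bF].
  exact: reach_refl.
by apply: reach_swap => //; apply: sXX.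
Qed.

(** Inversion exchanges positions and persons: swapping the positions [a], [b] in [t] means swapping
    [t a], [t b] in the inverse, and the adjacency conditions trade places. *)
Lemma reach_inv (V : finType) (X Y : rel V) (F : {set V}) (s t : {perm V}) :
  reach X Y F s t -> reach Y X (s @: F) s^-1%g t^-1%g.
Proof.
move: t; apply: reach_ind => [|t a b st IH Xab Yab aF bF]; first exact: reach_refl.
have E : s @: F = t @: F.
  by apply: eq_in_imset => x xF; rewrite (reach_fix st).
have -> : ((tperm a b * t)^-1 = tperm (t a) (t b) * t^-1)%g.
  by rewrite invMg tpermV -tpermJ conjgE !mulgA mulgK.
apply: reach_swap => //; rewrite ?permK // E mem_imset //; exact: perm_inj.
Qed.

Lemma routable_inv (V : finType) (X Y : rel V) : routable X Y -> routable Y X.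
Proof.
move=> rt s F a w aF sFw cF.
have [|||t st ta] := rt s^-1%g (s @: F) w a.
- by apply/imsetP=> -[x xF E]; apply: (sFw _ xF).
- by move=> _ /imsetP[x xF ->]; rewrite permK => E; move: aF; rewrite -E xF.
- by rewrite card_imset //; apply: perm_inj.
exists t^-1%g; last by rewrite -ta permK.
have := reach_inv st; rewrite invgK (_ : s^-1%g @: (s @: F) = F) //.
by apply/setP=> x; rewrite -imset_comp (eq_imset _ (permK s)) imset_id.
Qed.

(** * The complete bipartite case and the parity invariant *)

Section CompleteBipartite.
Variables (V : finType) (side : V -> bool) (n : nat).
Hypothesis card_sd : forall b, #|sd side b| = n.
Hypothesis n_ge2 : 1 < n.
Implicit Types s t g : {perm V}.

Definition opposite : rel V := fun x y => side x != side y.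

Local Notation reachK := (reach opposite opposite set0).

Definition preserving s := [forall x, side (s x) == side x].

Lemma preservingP s : reflect (forall x, side (s x) = side x) (preserving s).
Proof. by apply: (iffP forallP) => h x; apply/eqP. Qed.

(** Maximize the number of persons on their own side. By [balanced], a misplaced person has a
    misplaced counterpart on the other side, and swapping the two would increase the number. *)
Lemma reach_preserving s : exists2 t, reachK s t & preserving t.
Proof.
have [t st tmax] := reach_max opposite opposite set0 s
  (fun t => #|[set x | side (t x) == side x]|).
exists t => //; apply/preservingP=> x; apply/eqP/contraT=> nx.
have x1 : x \in [set y | (side y == side x) && (side (t y) == ~~ side x)].
  by rewrite inE eqxx /=; move: nx; case: (side (t x)); case: (side x).
have /set0Pn[y] : [set y | (side y == ~~ side x) && (side (t y) == ~~ ~~ side x)] != set0.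
  by rewrite -card_gt0 -(balanced _ _ _ card_sd) card_gt0; apply/set0Pn; exists x.
rewrite negbK inE => /andP[/eqP ys /eqP ty].
have nxs : side (t x) = ~~ side x by move: nx; case: (side (t x)); case: (side x).
have tv : reachK t (tperm x y * t)%g.
  apply: reach_swap; rewrite ?inE ?reach_refl // /opposite ?ys ?ty ?nxs //;
  by case: (side x).
have := tmax _ tv; rewrite leqNgt => /negP; case.
apply: (@leq_trans #|x |: [set z | side (t z) == side z]|).
  by rewrite cardsU1 inE nx.
apply: subset_leq_card; apply/subsetP=> z; rewrite !inE permM.
case: eqP => [->|zx] /=; first by rewrite tpermL ty eqxx.
move=> tz; rewrite tpermD //; first by rewrite eq_sym; apply/eqP.
by apply: contraTneq tz => <-; rewrite ty ys; case: (side x).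
Qed.

(** The product is obtained from four swaps across the sides, namely [a b], [a' b'], [a b'], [a' b]
    in this order; each time the two persons involved come from different sides. *)
Lemma reach_double s a a' b b' : preserving s -> a != a' -> b != b' ->
  side a' = side a -> side b' = side b -> side b = ~~ side a ->
  reachK s (tperm a a' * (tperm b b' * s))%g.
Proof.
move=> /preservingP ps naa nbb sa sb sab.
have nab x y : side x = side a -> side y = side b -> x != y.
  by move=> xa yb; apply: contraTneq isT => E; move: xa; rewrite E yb sab; case: (side a).
have u4 : uniq [:: a; a'; b; b'].
  by rewrite /= !inE !negb_or naa nbb !nab.
pose f := nth a [:: a; a'; b; b'].
have fi i j : i < 4 -> j < 4 -> f i = f j -> i = j.
  by move=> im jm /eqP; rewrite /f nth_uniq // => /eqP.
have E : word_perm f [:: (1, 2); (0, 3); (1, 3); (0, 2)] = word_perm f [:: (0, 1); (2, 3)].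
  by apply: (word_perm_eq fi).
have -> : (tperm a a' * (tperm b b' * s) =
  tperm a' b * (tperm a b' * (tperm a' b' * (tperm a b * s))))%g.
  by have /= := congr1 (fun g => g * s)%g E; rewrite !mulg1 -!mulgA => ->.
have op x y : side x = side a -> side y = side b -> opposite x y.
  by rewrite /opposite => -> ->; rewrite sab; case: (side a).
have nba x y : side x = side b -> side y = side a -> x != y.
  by move=> xb ya; rewrite eq_sym nab.
have na'a : a' != a by rewrite eq_sym.
have nb'b : b' != b by rewrite eq_sym.
have [n1 n2 n3 n4] : [/\ a != b, a != b', a' != b & a' != b'] by rewrite !nab.
have [n5 n6 n7 n8] : [/\ b != a, b != a', b' != a & b' != a'] by rewrite !nba.
have step t x y : reachK s t -> side x = side a -> side y = side b ->
    opposite (t x) (t y) -> reachK s (tperm x y * t)%g.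
  by move=> *; apply: reach_swap; rewrite ?inE // op.
apply: (@step) => //; first apply: (@step) => //; first apply: (@step) => //.
- by apply: (@step); rewrite ?reach_refl ?op ?ps.
- by rewrite !permM !tpermD //; apply: (@op); rewrite ps.
- rewrite !permM (tpermD (x := a') (y := b') (z := a)) // tpermL tpermR.
  rewrite (tpermD (x := a) (y := b) (z := a')) //.
  by rewrite /opposite !ps sa sab; case: (side a).
rewrite !permM (tpermD (x := a) (y := b') (z := a')) // tpermL.
rewrite (tpermD (x := a) (y := b) (z := b')) // (tpermD (x := a) (y := b') (z := b)) //.
rewrite (tpermD (x := a') (y := b') (z := b)) // tpermR.
by rewrite /opposite !ps sb sab; case: (side a).
Qed.

Lemma preservingM s t : preserving s -> preserving t -> preserving (s * t)%g.
Proof.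
move=> /preservingP ps /preservingP pt; apply/preservingP=> x.
by rewrite permM pt ps.
Qed.

Lemma preserving_tperm a b : side a = side b -> preserving (tperm a b).
Proof. by move=> ab; apply/preservingP=> x; case: tpermP => // ->. Qed.

Lemma two_on_side b : exists x y, [/\ x != y, side x = b & side y = b].
Proof.
have : 1 < #|sd side b| by rewrite card_sd.
case/card_gt1P=> x [y []]; rewrite !inE => /eqP xb /eqP yb nxy.
by exists x, y.
Qed.

(** If both transpositions lie on one side, an auxiliary transposition of the other side is used
    twice and cancels. *)
Lemma reach_pair s a a' b b' : preserving s -> a != a' -> b != b' ->
  side a' = side a -> side b' = side b ->
  reachK s (tperm a a' * (tperm b b' * s))%g.
Proof.
move=> ps naa nbb sa sb; have [E|NE] := eqVneq (side b) (side a); last first.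
  by apply: reach_double => //; move: NE; case: (side a); case: (side b).
have [c [c' [ncc sc sc']]] := two_on_side (~~ side a).
have st : reachK s (tperm c c' * (tperm b b' * s))%g.
  by apply: reach_double => //; rewrite ?sc ?sc' ?E ?negbK.
have ps' : preserving (tperm c c' * (tperm b b' * s))%g.
  by rewrite !preservingM // preserving_tperm ?sc ?sc'.
have := reach_double (a := a) (a' := a') (b := c) (b' := c') ps' naa ncc sa.
rewrite sc sc' [(tperm c c' * (tperm c c' * _))%g]mulgA tperm2 mul1g => h.
by apply: (reach_trans st); apply: h.
Qed.

(** Induction on the number of moved points: peeling [tperm x (g x)] off [g] fixes [x] and flips the
    parity. Each such transposition is paired with [tperm a0 a1] so that [reach_pair] applies. *)
Lemma reach_even g : preserving g ->
  forall a0 a1, a0 != a1 -> side a1 = side a0 -> forall s, preserving s ->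
  reachK s (if odd_perm g then g * (tperm a0 a1 * s) else g * s)%g.
Proof.
have [k] := ubnP #|[set x | g x != x]|; elim: k g => // k IHk g ltk pg a0 a1 n01 s01 s ps.
have /preservingP pgP := pg.
case: (pickP (fun x => g x != x)) => [x gx|g1]; last first.
  have -> : g = 1%g by apply/permP=> x; rewrite perm1; apply/eqP; have /negbFE := g1 x.
  by rewrite odd_perm1 mul1g reach_refl.
pose t := tperm x (g x); pose g' := (g * t)%g.
have pt : preserving t by apply: preserving_tperm; rewrite pgP.
have gE : g = (g' * t)%g by rewrite /g' -mulgA tperm2 mulg1.
have ot : odd_perm t = true by rewrite odd_tperm eq_sym.
have og : odd_perm g = ~~ odd_perm g' by rewrite {1}gE odd_permM ot addbT.
have lt' : #|[set y | g' y != y]| < k.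
  rewrite -ltnS; apply: leq_trans ltk; rewrite ltnS; apply: proper_card.
  apply/properP; split; last by exists x; rewrite !inE // permM tpermR eqxx.
  apply/subsetP=> y; rewrite !inE; apply: contraNN => /eqP gy.
  rewrite permM gy tpermD //; first by apply: contraNneq gx => ->; rewrite gy.
  by apply: contraNneq gx => E; apply/eqP/(@perm_inj _ g); rewrite E gy.
have pg' : preserving g' by apply: preservingM.
have IH := IHk _ lt' pg' _ _ n01 s01; rewrite og.
have p0 : preserving (tperm a0 a1) by apply: preserving_tperm.
case: (boolP (odd_perm g')) IH => /= _ IH.
  have h := reach_pair (a := a0) (a' := a1) (b := x) (b' := g x) ps n01.
  apply: (reach_trans (h _ _ _)) => //; rewrite ?pgP // 1?eq_sym //.
  have := IH _ (preservingM p0 (preservingM pt ps)).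
  by rewrite [(tperm a0 a1 * (tperm a0 a1 * _))%g]mulgA tperm2 mul1g [(g' * (t * s))%g]mulgA -gE.
have h := reach_pair (a := x) (a' := g x) (b := a0) (b' := a1) ps.
apply: (reach_trans (h _ _ _ _)) => //; rewrite ?pgP // 1?eq_sym //.
have := IH _ (preservingM pt (preservingM p0 ps)).
by rewrite [(g' * (t * _))%g]mulgA -gE.
Qed.

Definition invariant_bit s := odd_perm s (+) odd #|[set x | side x && side (s x)]|.

(** The swap flips the sign. It also changes the number of left persons on left positions by exactly
    one, as just one of the two positions is left and the two persons come from different sides. *)
Lemma invariant_bit_swap s a b : opposite a b -> opposite (s a) (s b) ->
  invariant_bit (tperm a b * s)%g = invariant_bit s.
Proof.
wlog sa : a b / side a.
  move=> H; case: (boolP (side a)) => [|na oab osab]; first exact: H.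
  rewrite tpermC; apply: H; rewrite /opposite 1?eq_sym //.
  by move: oab; rewrite /opposite (negbTE na); case: (side b).
rewrite /opposite sa => sb osab.
have nab : a != b by apply: contraNneq sb => <-; rewrite sa.
have sbF : side b = false by move: sb; case: (side b).
rewrite /invariant_bit odd_permM odd_tperm nab.
set S := [set x | side x & side ((tperm a b * s)%g x)].
set S' := [set x | side x & side (s x)].
have E : S :\ a = S' :\ a.
  apply/setP=> x; rewrite !inE permM; have [->|xa] //= := eqVneq x a.
  have [->|xb] := eqVneq x b; first by rewrite sbF.
  by rewrite tpermD // eq_sym.
rewrite (cardsD1 a S) (cardsD1 a S') E !oddD !inE sa permM tpermL /= !oddb.
by move: osab; case: (side (s a)); case: (side (s b)); case: (odd_perm s); case: (odd _).
Qed.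

Lemma invariant_bit_reach (X Y : rel V) s t : subrel X opposite -> subrel Y opposite ->
  reach X Y set0 s t -> invariant_bit t = invariant_bit s.
Proof.
move=> sX sY; move: t; apply: reach_ind => // t a b _ <- Xab Yab _ _.
by apply: invariant_bit_swap; [apply: sX | apply: sY].
Qed.

Lemma opposite_sym : symmetric opposite.
Proof. by move=> x y; rewrite /opposite eq_sym. Qed.

(** Sort both states so that sides are preserved. The invariant then reduces to the sign, and the
    sorted states differ by an even permutation. *)
Lemma reach_complete s t : invariant_bit s = invariant_bit t -> reachK s t.
Proof.
have [s' ss' ps] := reach_preserving s; have [t' tt' pt] := reach_preserving t.
rewrite -(invariant_bit_reach _ _ ss') // -(invariant_bit_reach _ _ tt') // => E.
have pE u : preserving u -> [set x | side x && side (u x)] = [set x | side x].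
  by move=> /preservingP pu; apply/setP=> x; rewrite !inE pu andbb.
have {}E : odd_perm s' = odd_perm t'.
  by move: E; rewrite /invariant_bit !pE // => /addIb.
apply: (reach_trans ss'); rewrite (reach_sym _ opposite_sym opposite_sym).
apply: (reach_trans tt'); rewrite (reach_sym _ opposite_sym opposite_sym).
have pi : preserving s'^-1%g.
  by apply/preservingP=> x; rewrite -{2}[x](permKV s'); have /preservingP-> := ps.
have [a [b [nab sa sb]]] := two_on_side true.
have := reach_even (preservingM pt pi) nab _ ps.
rewrite sa sb odd_permM odd_permV E addbb -mulgA mulVg mulg1; exact.
Qed.

Lemma invariant_bit_onto b : exists s, invariant_bit s = b.
Proof.
have [a [a' [naa sa sa']]] := two_on_side false.
have E : invariant_bit (tperm a a') = ~~ invariant_bit 1%g.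
  rewrite /invariant_bit odd_tperm odd_perm1 naa /=; congr (~~ odd _).
  by apply: eq_card => x; rewrite !inE perm1; case: tpermP => // ->; rewrite sa ?sa'.
have [<-|] := eqVneq (invariant_bit 1%g) b; first by exists 1%g.
by move=> nb; exists (tperm a a'); rewrite E; move: nb; case: b; case: (invariant_bit _).
Qed.

End CompleteBipartite.

(** * From routing and exchanges to exactly two components *)

Lemma n_comp_two (T : finType) (r : rel T) (f : T -> bool) : connect_sym r ->
  (forall x y, connect r x y = (f x == f y)) -> (forall b, exists x, f x = b) ->
  n_comp r T = 2.
Proof.
move=> rs rf fo; have [x0 f0] := fo false; have [x1 f1] := fo true.
have E : [predI fingraph.roots r & T] =i
    pred2 (fingraph.root r x0) (fingraph.root r x1).
  move=> x; rewrite !inE andbT; apply/eqP/orP => [<-|[/eqP->|/eqP->]]; rewrite ?root_root //.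
  case: (boolP (f x)) => fx; [right|left]; rewrite root_connect // rf ?f0 ?f1 ?fx //.
  by rewrite (negbTE fx).
by rewrite /n_comp_mem (eq_card E) card2 root_connect // rf f0 f1.
Qed.

Section TwoComponents.
Variables (V : finType) (side : V -> bool) (n : nat) (X Y : sgraph V).
Hypothesis card_sd : forall b, #|sd side b| = n.
Hypothesis n_ge8 : 7 < n.
Hypotheses (Xbip : bipartite side X) (Ybip : bipartite side Y).
Hypothesis XY_routable : routable X Y.
Hypotheses (Xtheta : forall a b, side b = ~~ side a -> theta_at X a b)
           (Ytheta : forall a b, side b = ~~ side a -> theta_at Y a b).
Hypothesis Ydeg : forall x, 7 <= #|nbr Y [set x]|.

Local Notation opp := (opposite side).

Lemma bip_opposite (R : rel V) : bipartite side R -> subrel R opp.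
Proof. by move=> Rb x y /Rb; rewrite /opposite => ->; case: (side x). Qed.

Lemma oppP a b : opp a b -> side b = ~~ side a.
Proof. by rewrite /opposite; case: (side a); case: (side b). Qed.

Lemma reach_lift_l s t : reach opp Y set0 s t -> reach X Y set0 s t.
Proof.
move: t; apply: reach_ind => [|t a b _ st ab Yab _ _]; first exact: reach_refl.
apply: (reach_trans st); apply: exchange => //; first exact: edge_sym.
- exact: edge_sym.
- exact: edge_irrefl.
by apply: Xtheta; apply: oppP.
Qed.

(** [exchange] is applied to the inverse states, where [Y] joins the positions and the complete
    bipartite graph joins the persons. *)
Lemma reach_lift_r s t : reach opp opp set0 s t -> reach opp Y set0 s t.
Proof.
move: t; apply: reach_ind => [|t a b _ st ab tab _ _]; first exact: reach_refl.
apply: (reach_trans st).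
have rt : routable Y opp.
  apply: routable_inv => s' F x w xF sF cF.
  have [t' st' tx] := XY_routable xF sF cF; exists t' => //.
  by apply: reach_mono st'; apply: bip_opposite.
have := @exchange _ Y opp _ _ t^-1%g (t a) (t b) _ rt.
rewrite !permK => h.
have {}h : reach Y opp set0 t^-1%g (tperm (t a) (t b) * t^-1)%g.
  apply: h => //; first exact: edge_sym; first exact: opposite_sym.
  - by move=> x; rewrite /opposite eqxx.
  - by apply: Ytheta; apply: oppP.
  apply: leq_trans (ltnW n_ge8) _; rewrite -(card_sd (~~ side a)); apply: subset_leq_card.
  apply/subsetP=> x; rewrite !inE => /eqP sx; apply/existsP; exists a.
  by rewrite inE eqxx /opposite sx; case: (side a).
have := reach_inv h; rewrite imset0 invgK.
by rewrite invMg invgK tpermV -tpermJ conjgE mulKVg.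
Qed.

Lemma FS_connectE s t : connect (FS X Y) s t =
  (invariant_bit side s == invariant_bit side t).
Proof.
have -> : connect (FS X Y) s t = reach X Y set0 s t.
  apply: eq_connect => {}s {}t; apply/existsP/mvP => [[a /existsP[b /and3P[h1 h2 /eqP h3]]]|].
    by exists a, b; rewrite !inE h3 mulgA tperm2 mul1g -h3; split.
  case=> a [b [h1 h2 _ _ ->]]; exists a; apply/existsP; exists b.
  by rewrite h1 h2 mulgA tperm2 mul1g eqxx.
apply/idP/eqP => [st|E].
  by rewrite (invariant_bit_reach _ _ st) //; apply: bip_opposite.
by apply: reach_lift_l; apply: reach_lift_r; apply: reach_complete => //; apply: ltn_trans n_ge8.
Qed.

Lemma FS_two_components : ncomponents (FS X Y) = 2.
Proof.
apply: n_comp_two FS_connectE _; first exact/sym_connect_sym/edge_sym.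
by apply: invariant_bit_onto => //; apply: ltn_trans n_ge8.
Qed.

End TwoComponents.

(** * Theta subgraphs of pseudorandom graphs *)

Section ThetaSubgraph.
Variables (V : finType) (side : V -> bool) (R : rel V) (n e D : nat).
Hypotheses (Rsym : symmetric R) (Rbip : bipartite side R).
Hypotheses (Redge : edge_between side e R) (Rexp : expanding side n D R).
Hypotheses (Dn : D * 2 <= n) (De : e + 8 <= D).

(** Outside [l] both [a] and [b] keep at least [e] neighbours, on opposite sides, so an edge joins
    the two neighbourhoods. *)
Lemma fresh_path (l : seq V) a b : side b = ~~ side a -> uniq l -> size l <= 8 ->
  exists x y, [/\ R a x, R x y, R y b & uniq (l ++ [:: x; y])].
Proof.
move=> ab ul sl; pose L := [set z in l].
have cL : #|L| <= 8 by rewrite cardsE; apply: leq_trans (card_size l) sl.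
have big c : e <= #|nbr R [set c] :\: L|.
  have h1 := leq_card_setD (nbr R [set c]) L.
  by have h2 := card_nbr1 c Dn Rexp; move: h1 h2 cL De; clear; lia.
have sub c : nbr R [set c] :\: L \subset sd side (~~ side c).
  by apply: subset_trans (subsetDl _ _) (nbr1_sd _ Rbip).
have sb := sub b; rewrite ab in sb.
have [x [y [xA yB Rxy]]] := Redge (sub a) sb (big a) (big b).
move: xA yB; rewrite !in_setD !in_nbr1 !inE => /andP[xl Rax] /andP[yl Rby].
exists x, y; split=> //; first by rewrite Rsym.
rewrite cat_uniq ul /= !inE orbF negb_or xl yl /= andbT.
by apply: contraTneq Rxy => ->; apply/negP=> /Rbip; case: (side y).
Qed.

Lemma theta_exists a b : side b = ~~ side a -> theta_at R a b.
Proof.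
move=> ab; have u2 : uniq [:: a; b].
  by rewrite /= inE andbT; apply: contraTneq isT => E; move: ab; rewrite E; case: (side b).
have [x1 [y1 [h1 h1' h1'' u4]]] := fresh_path ab u2 isT.
have [x2 [y2 [h2 h2' h2'' u6]]] := fresh_path ab u4 isT.
have [x3 [y3 [h3 h3' h3'' u8]]] := fresh_path ab u6 isT.
exists (nth a [:: a; b; x1; y1; x2; y2; x3; y3]); split=> //.
  by move=> i j im jm /eqP; rewrite nth_uniq // => /eqP.
move=> i j; rewrite !inE.
by do ! [case/orP]; move=> /eqP[-> ->].
Qed.

End ThetaSubgraph.

(** * Choice of parameters in the deterministic argument *)

Section Pseudorandom.
Variables (V : finType) (side : V -> bool) (n K h : nat) (X Y : sgraph V).
Let e := 14 * (K * h).
Let M := 640 * (K * e).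
Let D := 2 * M.
Hypothesis card_sd : forall b, #|sd side b| = n.
Hypotheses (K_gt0 : 0 < K) (h_gt0 : 0 < h) (n2K : n < 2 ^ K).
Hypothesis n_big : 4096 * (4096 * (4096 * (K * K * K * (h * h)))) <= n.
Hypotheses (Xbip : bipartite side X) (Ybip : bipartite side Y).
Hypotheses (Xedge : edge_between side e X) (Yedge : edge_between side e Y).
Hypotheses (Xexp : expanding side n D X) (Yexp : expanding side n D Y).
Hypothesis XYjoint : joint side n e X Y.

Lemma pseudorandom_two_components : ncomponents (FS X Y) = 2.
Proof.
have [A0 [w2 [Kw KA]]] : 0 < K * K * K * (h * h) /\
    (K * h) * (K * h) <= K * K * K * (h * h) /\ K * (K * h) <= K * K * K * (h * h) /\
    K <= K * K * K * (h * h).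
  move: K_gt0 h_gt0; clear; case: K => // k; case: h => // l _ _.
  by rewrite !muln_gt0; nia.
have eE : e * e = 196 * ((K * h) * (K * h)) by rewrite /e; lia.
have KeE : K * e = 14 * (K * (K * h)) by rewrite /e; lia.
have e14 : 14 <= e by rewrite /e; move: K_gt0 h_gt0; clear; nia.
move: (K * K * K * (h * h)) (K * h * (K * h)) (K * (K * h)) n_big A0 w2 Kw KA eE KeE
  => A w2 Kw nA A0 w2A KwA KA eE KeE.
have eKe : e <= K * e by rewrite leq_pmull.
have Mbig : 640 * e <= M by rewrite /M leq_mul2l eKe.
have ME : M = 640 * (K * e) by [].
have DE : D = 2 * M by [].
have e_gt0 : 0 < e by apply: leq_trans e14.
have nM : 2000 * M <= n by rewrite ME KeE; move: nA KwA; clear; lia.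
have M_gt0 : 0 < M by move: Mbig e_gt0; clear; lia.
pose q0 := (n %/ 10).+1.
have q0n : n <= 10 * q0 by rewrite mulnC ltnW // ltn_ceil.
have q0n' : 10 * q0 <= n + 10 by have := leq_trunc_div n 10; rewrite /q0; clear; lia.
(* At most [K] steps then lose about [n / 16] positions in total, and [q0 + J * d] stays below
   [n / 4]. *)
pose d := (n %/ (16 * K)).+1.
have dn : n <= 16 * (K * d) by rewrite mulnA mulnC ltnW // ltn_ceil // muln_gt0.
have dn' : 16 * (K * d) <= n + 16 * K.
  by have := leq_trunc_div n (16 * K); rewrite /d mulnS; clear; lia.
(* The iteration starts from [M * 16 ^ J] persons, which lies between [n / 1600] and [n / 100] as
   [mixing_base] demands. *)
pose J := trunc_log 16 (n %/ (100 * M)).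
have M1 : 0 < n %/ (100 * M) by rewrite divn_gt0; [move: nM; clear; lia|move: M_gt0; clear; lia].
have /andP[J1 J2] := trunc_log_bounds (isT : 1 < 16) M1; rewrite -/J in J1 J2.
have mJ : 100 * (M * 16 ^ J) <= n.
  rewrite mulnA mulnC; apply: leq_trans (leq_trunc_div n (100 * M)).
  by rewrite leq_mul2r J1 orbT.
have mJ' : n <= 1600 * (M * 16 ^ J).
  have : n < (n %/ (100 * M)).+1 * (100 * M) by apply: ltn_ceil; move: M_gt0; clear; lia.
  have : (n %/ (100 * M)).+1 * (100 * M) <= 16 ^ J.+1 * (100 * M).
    by rewrite leq_mul2r J2 orbT.
  by rewrite expnS; clear; lia.
have JK : J <= K.
  rewrite -(leq_exp2l _ _ (isT : 1 < 2)); apply: ltnW; apply: leq_ltn_trans n2K.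
  apply: leq_trans (leq_div n (100 * M)); apply: leq_trans J1.
  by case: (J) => [|k]; rewrite ?expn0 // leq_exp2r.
have wl : mixing side X Y M (q0 + J * d).
  apply: (mixing_iter Ybip card_sd XYjoint e_gt0 Yexp).
  (* This is the least [g] with [g * D > 18 * m]. *)
  - move=> m Mm mn; pose g := (18 * m %/ D).+1; exists g.
    have g1 : 18 * m < g * D by apply: ltn_ceil; rewrite DE; move: M_gt0; clear; lia.
    have g2 : g * D <= 18 * m + D by rewrite /g mulSn addnC leq_add2r leq_trunc_div.
    have g3 : g * D <= 20 * m by move: g2 Mm; rewrite DE; clear; lia.
    have gE : g * D = 1280 * (g * (K * e)) by rewrite DE ME; clear; lia.
    have g4 : 64 * (g * (K * e)) <= m by move: g3; rewrite gE; clear; lia.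
    have g5 : g <= g * (K * e) by rewrite leq_pmulr //; apply: leq_trans eKe.
    have g6 : m <= 2 * (m - 2 * g) by move: g4 g5; clear; lia.
    split=> //; [exact: ltnW | by move: g3 mn mJ; clear; lia |].
    have a1 : 64 * (g * (K * e)) * d <= m * d by rewrite leq_mul2r g4 orbT.
    have a2 : m * d <= 2 * (m - 2 * g) * d by rewrite leq_mul2r g6 orbT.
    have a3 : g * e * n <= g * e * (16 * (K * d)) by rewrite leq_mul2l dn orbT.
    have e1 : 64 * (g * (K * e)) * d = 4 * (g * e * (16 * (K * d))) by clear; lia.
    have e2 : 2 * g * (n * e) = 2 * (g * e * n) by clear; lia.
    have e3 : 2 * (m - 2 * g) * d = 2 * ((m - 2 * g) * d) by rewrite mulnA.
    by rewrite e2; move: a1 a2 a3; rewrite e1 e3; clear; lia.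
  - have : J * d <= K * d by rewrite leq_mul2r JK orbT.
    by move: q0n' dn' mJ nA KA A0; clear; lia.
  apply: (mixing_base Xbip card_sd Yedge XYjoint e_gt0) => //.
  by rewrite eE; move: nA w2A; clear; lia.
have qn : 4 * (q0 + J * d) <= n.
  have : J * d <= K * d by rewrite leq_mul2r JK orbT.
  by move: q0n' dn' nA KA A0; clear; lia.
have Dn : D * 2 <= n by rewrite DE; move: nM; clear; lia.
have De : e + 8 <= D by rewrite DE; move: Mbig e14; clear; lia.
have rt : routable X Y.
  apply: (route (edge_sym X) (edge_sym Y) Xbip Ybip card_sd Xedge Yedge XYjoint e_gt0
    Xexp Yexp wl) => //.
  - by move: Mbig; clear; lia.
  - by move: e14; clear; lia.
  - by rewrite eE; move: nA w2A; clear; lia.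
  - by move: nM; clear; lia.
apply: (FS_two_components card_sd _ Xbip Ybip rt).
- by move: nA A0; clear; lia.
- by apply: (theta_exists (edge_sym X) Xbip Xedge Xexp Dn De).
- by apply: (theta_exists (edge_sym Y) Ybip Yedge Yexp Dn De).
by move=> x; apply: leq_trans (card_nbr1 x Dn Yexp); move: De; clear; lia.
Qed.

End Pseudorandom.

Import Order.TTheory GRing.Theory Num.Theory.
Local Open Scope ring_scope.

(** * The product measure on edge sets *)

Section ProductMeasure.
Variables (R : realType) (n : nat) (p : R).
Hypothesis p01 : 0 <= p <= 1.
Notation edges := ('I_n * 'I_n)%type.
Implicit Types (E B S : {set edges}) (A : pred {set edges}).

Let p_ge0 : 0 <= p. Proof. by case/andP: p01. Qed.
Let q_ge0 : 0 <= 1 - p. Proof. by rewrite subr_ge0; case/andP: p01. Qed.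
Let q_le1 : 1 - p <= 1. Proof. by rewrite lerBlDr lerDl. Qed.

Definition bip_prob A : R := \sum_(E | A E) bip_mass p E.

Lemma bip_mass_ge0 E : 0 <= bip_mass p E.
Proof. by apply: prodr_ge0 => e _; case: ifP. Qed.

Lemma bip_prob_le A A' : (forall E, A E -> A' E) -> bip_prob A <= bip_prob A'.
Proof.
move=> sub; rewrite /bip_prob big_mkcond [X in _ <= X]big_mkcond; apply: ler_sum => E _.
by case: ifP => [/sub->//|_]; case: ifP => // _; apply: bip_mass_ge0.
Qed.

Lemma bip_prob_exists (T : finType) (C : pred T) (A : T -> pred {set edges}) (c : R) :
  (forall x, C x -> bip_prob (A x) <= c) ->
  bip_prob (fun E => [exists x, C x && A x E]) <= #|C|%:R * c.
Proof.
move=> h; apply: (@le_trans _ _ (\sum_(x | C x) bip_prob (A x))); last first.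
  by rewrite mulr_natl -sumr_const; apply: ler_sum.
rewrite /bip_prob (exchange_big_dep xpredT) //= big_mkcond; apply: ler_sum => E _.
case: existsP => [[x /andP[Cx Ax]]|_]; last by apply: sumr_ge0 => x _; apply: bip_mass_ge0.
rewrite (bigD1 x) /=; last by rewrite Cx Ax.
by rewrite lerDl; apply: sumr_ge0 => y _; apply: bip_mass_ge0.
Qed.

(** Expanding the product over the edges gives a sum over edge sets, in which the terms violating a
    constraint vanish. *)
Lemma bip_prob_box (c : edges -> bool -> bool) :
  bip_prob (fun E => [forall e, c e (e \in E)]) =
  \prod_e ((if c e true then p else 0) + (if c e false then 1 - p else 0)).
Proof.
rewrite bigA_distr /bip_prob big_mkcond; apply: eq_bigr => E _.
case: forallP => [h|/forallP]; last first.
  rewrite negb_forall => /existsP[e ne]; rewrite (bigD1 e) //=.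
  by move: ne; case: (e \in E) => /negbTE->; rewrite mul0r.
by apply: eq_bigr => e _; have := h e; case: (e \in E) => ->.
Qed.

(* Reveal the edges outside B first: they determine S E, whose edges are
   still independent of what has been revealed. *)
Lemma bip_prob_avoid (S : {set edges} -> {set edges}) B L :
  (forall E, S E \subset B) -> (forall E, S E = S (E :\: B)) ->
  bip_prob (fun E => (L <= #|S E|)%N && [disjoint E & S E]) <= (1 - p) ^+ L.
Proof.
move=> SB SE; rewrite /bip_prob (partition_big (fun E => E :\: B) xpredT) //=.
have -> : (1 - p) ^+ L = (1 - p) ^+ L * \sum_(E : {set edges}) bip_mass p E.
  by rewrite bip_mass_sum1 mulr1.
rewrite [X in _ <= _ * X](partition_big (fun E => E :\: B) xpredT) //= mulr_sumr.
apply: ler_sum => E0 _.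
(* A set [E0] that meets [B] is never of the form [E :\: B]. *)
have [/eqP EB|EB] := boolP (E0 :&: B == set0); last first.
  rewrite big_pred0 => [|E]; last first.
    apply/negbTE; apply: contra EB => /andP[_ /eqP<-].
    by apply/eqP/setP=> e; rewrite !inE; case: (e \in B); rewrite ?andbF.
  by apply: mulr_ge0; [apply: exprn_ge0 | apply: sumr_ge0 => E _; apply: bip_mass_ge0].
have eqB E : (E :\: B == E0) = [forall e, (e \in B) || ((e \in E) == (e \in E0))].
  apply/eqP/forallP => [<- e|h].
    by rewrite inE; case: (e \in B) => //=; rewrite eqxx.
  apply/setP=> e; have := h e; rewrite inE; case: (boolP (e \in B)) => [eB _|_ /eqP] //=.
  by have := in_set0 e; rewrite -EB inE eB andbT => ->.
have [small|big] := ltnP #|S E0| L.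
  rewrite big_pred0 => [|E]; last first.
    by apply/negbTE/negP=> /andP[/andP[+ _] /eqP E0E]; rewrite SE E0E leqNgt small.
  by apply: mulr_ge0; [apply: exprn_ge0 | apply: sumr_ge0 => E _; apply: bip_mass_ge0].
(* Given [E0], the set [S E = S E0] is fixed. The edges outside [B] are prescribed and those in
   [S E0] must be absent, so the event constrains each edge separately. *)
pose c e b := ((e \in B) || (b == (e \in E0))) && (b ==> (e \notin S E0)).
apply: (@le_trans _ _ (bip_prob (fun E => [forall e, c e (e \in E)]))).
  apply: bip_prob_le => E /andP[/andP[_ dis] EE]; apply/forallP=> e; rewrite /c.
  move: (EE); rewrite eqB => /forallP/(_ e)-> /=; apply/implyP=> eE.
  by move: dis; rewrite disjoint_subset SE (eqP EE) => /subsetP/(_ _ eE); rewrite inE.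
rewrite (eq_bigl _ _ eqB).
rewrite -/(bip_prob (fun E => [forall e, (e \in B) || ((e \in E) == (e \in E0))])).
rewrite bip_prob_box (bip_prob_box (fun e b => (e \in B) || (b == (e \in E0)))).
apply: (@le_trans _ _ ((1 - p) ^+ #|S E0| * \prod_e
   ((if (e \in B) || (true == (e \in E0)) then p else 0) +
    (if (e \in B) || (false == (e \in E0)) then 1 - p else 0)))); last first.
  apply: ler_wpM2r; last exact: ler_wiXn2l.
  by apply: prodr_ge0 => e _; apply: addr_ge0; case: ifP.
rewrite -prodr_const [X in _ <= X * _]big_mkcond -big_split /=; apply: ler_prod => e _.
apply/andP; split; first by apply: addr_ge0; case: ifP.
rewrite /c /=; have /subsetP/(_ e) SBe := SB E0.
case: (boolP (e \in S E0)) => [/SBe-> /=|_]; last by rewrite mul1r !andbT.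
by rewrite add0r [p + _]addrC subrK mulr1.
Qed.

Lemma bip_prob_disjoint S : bip_prob (fun E => [disjoint E & S]) <= (1 - p) ^+ #|S|.
Proof.
have := @bip_prob_avoid (fun _ => S) S #|S| (fun _ => subxx _) (fun _ => erefl).
by apply: le_trans; apply: bip_prob_le => E; rewrite leqnn.
Qed.

Lemma bip_prob_le1 A : bip_prob A <= 1.
Proof. by rewrite -(bip_mass_sum1 n p); apply: bip_prob_le. Qed.

(** By Bernoulli, (1 + p)^h is at least 1 + p h, hence at least 2, while (1 - p)^h (1 + p)^h is at
    most 1. *)
Lemma pow_half h a : 1 <= p * h%:R -> (1 - p) ^+ (h * a) <= (2 ^+ a)^-1.
Proof.
move=> ph; rewrite exprM -exprVn; apply: lerXn2r; rewrite ?nnegrE ?exprn_ge0 ?invr_ge0 ?ler0n //.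
have h1 : (1 - p) ^+ h * (1 + p) ^+ h <= 1.
  rewrite -exprMn; apply: exprn_ile1.
    by apply: mulr_ge0 => //; apply: addr_ge0.
  by rewrite -subr_sqr expr1n lerBlDr lerDl sqr_ge0.
have h2 k : 1 + p * k%:R <= (1 + p) ^+ k.
  elim: k => [|k IHk]; first by rewrite mulr0 addr0 expr0.
  rewrite exprS; apply: le_trans (ler_wpM2l _ IHk); last by rewrite addr_ge0.
  have -> : (1 + p) * (1 + p * k%:R) = 1 + p * k.+1%:R + p * p * k%:R by rewrite -natr1; ring.
  by rewrite lerDl !mulr_ge0.
rewrite -[X in _ <= X]mul1r ler_pdivlMr ?ltr0n //; apply: le_trans h1.
apply: ler_wpM2l; first exact: exprn_ge0.
by apply: le_trans (h2 h); rewrite (_ : 2 = 1 + 1) // lerD2l.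
Qed.

End ProductMeasure.

(** * Counting subsets and permutations *)

Section Counting.
Local Open Scope nat_scope.

Lemma leq_bin_exp m k : 'C(m, k) <= m ^ k.
Proof.
elim: m k => [|m IHm] [|k] //; rewrite ?bin0 //.
rewrite binS; apply: leq_trans (leq_add (IHm _) (IHm _)) _.
rewrite !expnS -mulSnr; apply: leq_mul => //.
by case: k => // k; rewrite leq_exp2r.
Qed.

Lemma card_sets_of_size (T : finType) k a : #|T| <= 2 ^ a ->
  #|[pred U : {set T} | #|U| == k]| <= 2 ^ (a * k).
Proof.
move=> Ta; rewrite -(eq_card (A := mem [set U : {set T} | #|U| == k])) => [|U]; last first.
  by rewrite !inE.
rewrite card_draws; apply: leq_trans (leq_bin_exp _ _) _.
by rewrite expnM; case: k => // k; rewrite leq_exp2r.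
Qed.

Lemma card_sets_upto (T : finType) k a : #|T| <= 2 ^ a -> k < 2 ^ a ->
  #|[pred U : {set T} | #|U| <= k]| <= 2 ^ (a * k + a).
Proof.
move=> Ta ka; apply: (@leq_trans (\sum_(j < k.+1) #|[pred U : {set T} | #|U| == j]|)).
  rewrite -sum1_card (partition_big (fun U : {set T} => inord #|U| : 'I_k.+1) xpredT) //=.
  apply: leq_sum => j _; rewrite -sum1_card [X in X <= _]big_mkcond [X in _ <= X]big_mkcond.
  apply: leq_sum => U _; rewrite !inE; case: ifP => // /andP[Uk /eqP <-].
  by rewrite inordK // eqxx.
apply: (@leq_trans (\sum_(j < k.+1) 2 ^ (a * k))).
  apply: leq_sum => j _; apply: leq_trans (card_sets_of_size j Ta) _.
  by rewrite leq_exp2l // leq_mul2l -ltnS ltn_ord orbT.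
by rewrite sum_nat_const card_ord expnD mulnC leq_mul2l ka orbT.
Qed.

Lemma card_set_type (T : finType) : #|{set T}| = 2 ^ #|T|.
Proof.
by rewrite -cardsT -card_powerset; apply: eq_card => A; rewrite !inE subsetT.
Qed.

Lemma card_perm_type (T : finType) a : #|T| <= 2 ^ a -> #|{perm T}| <= 2 ^ (a * #|T|).
Proof.
move=> Ta; apply: (@leq_trans #|{ffun T -> T}|); first exact: leq_card val_inj.
by rewrite card_ffun expnM; case: #|T| Ta => // k; rewrite leq_exp2r.
Qed.

End Counting.

(** * Failure events for the pseudorandomness conditions *)

Section Parts.
Variable n : nat.
Notation V := ('I_n + 'I_n)%type.
Local Open Scope nat_scope.

Definition left_side (v : V) : bool := if v is inl _ then true else false.

Definition part (b : bool) (i : 'I_n) : V := if b then inl i else inr i.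

Definition trace (b : bool) (A : {set V}) : {set 'I_n} := [set i | part b i \in A].

Lemma part_inj b : injective (part b).
Proof. by case: b => i j []. Qed.

Lemma card_trace b (A : {set V}) : A \subset sd left_side b -> #|trace b A| = #|A|.
Proof.
move=> /subsetP Ab; rewrite -(card_imset _ (@part_inj b)); apply: eq_card => x.
apply/imsetP/idP => [[i + ->]|xA]; first by rewrite inE.
have := Ab _ xA; rewrite inE; case: x xA => i xA; case: b {Ab} => //= _; exists i => //;
  by rewrite inE.
Qed.

Lemma card_left_side b : #|sd left_side b| = n.
Proof.
rewrite -(card_trace (subxx _)) -[RHS]card_ord; apply: eq_card => i; rewrite !inE.
by case: b.
Qed.

Lemma bip_rel_bipartite (E : {set 'I_n * 'I_n}) : bipartite left_side (bip_rel E).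
Proof. by move=> [i|i] [j|j]. Qed.

Definition oriented (b : bool) (i j : 'I_n) := if b then (i, j) else (j, i).

Lemma bip_rel_part E b i j : bip_rel E (part b i) (part (~~ b) j) = (oriented b i j \in E).
Proof. by case: b. Qed.

Definition rect b (U W : {set 'I_n}) := if b then setX U W else setX W U.

Lemma in_rect b U W i j : (oriented b i j \in rect b U W) = (i \in U) && (j \in W).
Proof. by case: b; rewrite inE //= andbC. Qed.

Lemma card_rect b U W : #|rect b U W| = #|U| * #|W|.
Proof. by case: b; rewrite cardsX // mulnC. Qed.

Lemma orientedP b ij : exists i j, ij = oriented b i j.
Proof. by case: ij => i j; case: b; [exists i, j | exists j, i]. Qed.

(** Sets of size exactly [e] in one orientation keep the union bound small; larger sets contain such
    subsets. *)
Definition no_edge_event (e : nat) (E : {set 'I_n * 'I_n}) :=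
  [exists UW : {set 'I_n} * {set 'I_n},
     ((#|UW.1| == e) && (#|UW.2| == e)) && [disjoint E & rect true UW.1 UW.2]].

Lemma no_edge_eventN e E : ~~ no_edge_event e E -> edge_between left_side e (bip_rel E).
Proof.
rewrite negb_exists => /forallP H.
have main (A B : {set V}) : A \subset sd left_side true -> B \subset sd left_side false ->
    e <= #|A| -> e <= #|B| -> exists x y, [/\ x \in A, y \in B & bip_rel E x y].
  move=> At Bf; rewrite -(card_trace At) -(card_trace Bf).
  move=> /subset_of_card[U UA cU] /subset_of_card[W WB cW].
  have := H (U, W); rewrite /= cU cW eqxx /= disjoint_subset => /subsetPn[[i j] ijE].
  rewrite !inE negbK => /andP[/(subsetP UA) + /(subsetP WB)]; rewrite !inE => iA jB.
  by exists (inl i), (inr j).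
case=> A B AA BB eA eB; first exact: main.
have [x [y [xB yA xy]]] := main _ _ BB AA eB eA.
by exists y, x; rewrite bip_rel_sym.
Qed.

(** If [g] vertices have fewer than [g * D] neighbours, their neighbourhood can be enlarged to
    exactly [g * D] vertices, and no edge leads to the complement. *)
Definition no_expansion_event (D : nat) (b : bool) (E : {set 'I_n * 'I_n}) :=
  [exists g : 'I_n.+1, ((0 < g) && (g * D * 2 <= n)) &&
    [exists UZ : {set 'I_n} * {set 'I_n},
       ((#|UZ.1| == g) && (#|UZ.2| == g * D)) && [disjoint E & rect b UZ.1 (~: UZ.2)]]].

Lemma no_expansion_eventN D E :
  (forall b, ~~ no_expansion_event D b E) -> expanding left_side n D (bip_rel E).
Proof.
move=> H b U Ub gn; rewrite leqNgt; apply/negP=> small.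
have Nb := nbr_sd (@bip_rel_bipartite E) Ub.
have gle : #|U| < n.+1.
  by rewrite ltnS; apply: leq_trans (subset_leq_card Ub) _; rewrite card_left_side.
have [||Z ZN cZ] := @superset_of_card _ (trace (~~ b) (nbr (bip_rel E) U)) (#|U| * D).
- by rewrite card_trace // ltnW.
- by rewrite card_ord; move: gn; clear; lia.
have /negP := H b; apply; apply/existsP; exists (Ordinal gle); rewrite /= gn andbT.
apply/andP; split; first by rewrite lt0n; apply: contraTneq small => ->; rewrite mul0n.
apply/existsP; exists (trace b U, Z); rewrite /= card_trace // cZ !eqxx /=.
rewrite disjoint_subset; apply/subsetP=> ij; have [i [j ->]] := orientedP b ij => ijE.
rewrite inE in_rect !inE negb_and negbK; case: (boolP (part b i \in U)) => //= iU.
apply: (subsetP ZN); rewrite !inE; apply/existsP; exists (part b i).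
by rewrite iU bip_rel_part.
Qed.

(** Moves never use an X-edge at [F]; this is the independence behind [joint]. *)
Lemma eq_reach (T : finType) (X X' Y : rel T) (F : {set T}) :
  (forall a b, a \notin F -> b \notin F -> X a b = X' a b) ->
  reach X Y F =2 reach X' Y F.
Proof.
move=> XX; apply: eq_connect => s t; apply: eq_existsb => a; apply: eq_existsb => b.
by case: (boolP (a \in F)) => aF; case: (boolP (b \in F)) => bF; rewrite ?andbF //= XX.
Qed.

Lemma eq_avail (T : finType) (sd : T -> bool) (X X' Y : rel T) s F H Q P z :
  reach X Y F =2 reach X' Y F ->
  avail sd X Y s F H Q P z = avail sd X' Y s F H Q P z.
Proof.
move=> XX; apply/setP=> y; rewrite !inE; do ! congr (_ && _).
by apply: eq_existsb => t; rewrite XX.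
Qed.

Definition blocked (n e : nat) (T : finType) (sd : T -> bool) (X Y : rel T)
    s F (W : {set T}) (H : {set T * T}) Q P :=
  (n * e <= \sum_(z in W) #|avail sd X Y s F H Q P z|) &&
  [forall z in W, forall y in avail sd X Y s F H Q P z, ~~ X z y].

Lemma joint_blocked (e m : nat) (T : finType) (sd : T -> bool) (X Y : rel T) :
  (forall s (F W : {set T}) (H : {set T * T}) Q P, W \subset F -> #|H| <= m ->
     ~~ blocked m e sd X Y s F W H Q P) -> joint sd m e X Y.
Proof.
move=> nb s F W H Q P WF Hm big; have := nb s F W H Q P WF Hm.
rewrite /blocked big /= negb_forall => /existsP[z].
rewrite negb_imply => /andP[zW]; rewrite negb_forall => /existsP[y].
by rewrite negb_imply negbK => /andP[yA Xzy]; exists z, y.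
Qed.

Definition edge_of (zy : V * V) : option ('I_n * 'I_n) :=
  match zy with
  | (inl i, inr j) => Some (i, j)
  | (inr j, inl i) => Some (i, j)
  | _ => None
  end.

End Parts.

(** * The probability of a blocked configuration *)

Section Blocked.
Variables (R : realType) (n : nat) (p : R).
Hypothesis p01 : 0 <= p <= 1.
Notation V := ('I_n + 'I_n)%type.
Local Notation ls := (@left_side n).

(** The edges that would join [W] to the sets [avail] form a set [S E] of edges at [F], determined
    by the edges of [E] not touching [F]. Once the latter are revealed, being blocked means that all
    of [S E], at least [n * e] edges, is missing. *)
Lemma prob_blocked e (Y : rel V) (s : {perm V}) (F W : {set V}) (H : {set V * V}) Q P :
  W \subset F ->
  bip_prob p (fun E => blocked n e ls (bip_rel E) Y s F W H Q P) <= (1 - p) ^+ (n * e).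
Proof.
move=> WF.
have [av avE] : exists f, forall E, f E =1 avail ls (bip_rel E) Y s F H Q P.
  by exists (fun E => avail ls (bip_rel E) Y s F H Q P).
have [pairs pairsE] : exists f, forall (E : {set 'I_n * 'I_n}) (zy : V * V),
    (zy \in (f E : {set V * V})) = (zy.1 \in W) && (zy.2 \in av E zy.1).
  exists (fun E => [set zy : V * V | (zy.1 \in W) && (zy.2 \in av E zy.1)]) => E zy.
  by rewrite in_set.
pose S E := [set ij | Some ij \in (@edge_of n) @: pairs E].
pose B := [set ij : 'I_n * 'I_n | (inl ij.1 \in F) || (inr ij.2 \in F)].
have avF E z y : y \in av E z -> y \notin F /\ ls y != ls z.
  by rewrite avE => /availP[].
have SB E : S E \subset B.
  apply/subsetP=> -[i j]; rewrite !inE => /imsetP[[z y]]; rewrite pairsE /= => /andP[zW _].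
  by case: z zW => k /(subsetP WF) kF; case: y => l //= [-> ->]; rewrite kF ?orbT.
have SE E : S E = S (E :\: B).
  have avB : av E =1 av (E :\: B).
    move=> z; rewrite !avE; apply: eq_avail; apply: eq_reach => -[i|i] [j|j] // iF jF /=.
      by rewrite !inE /= (negbTE iF) (negbTE jF).
    by rewrite !inE /= (negbTE iF) (negbTE jF).
  have pE : pairs E = pairs (E :\: B) by apply/setP=> zy; rewrite !pairsE avB.
  by rewrite /S pE.
have cS E : (\sum_(z in W) #|av E z| <= #|S E|)%N.
  have -> : (\sum_(z in W) #|av E z| = #|pairs E|)%N.
    under eq_bigr do rewrite -sum1_card.
    by rewrite pair_big_dep /= -sum1_card; apply: eq_bigl => zy; rewrite pairsE.
  (* The first vertex of a pair is in [F] and the second is not, so an edge comes from one pair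
     only. *)
  have inj : {in pairs E &, injective (@edge_of n)}.
    move=> [z y] [z' y']; rewrite !pairsE /= => /andP[zW /avF[yF zy]] /andP[zW' /avF[yF' zy']].
    move: (subsetP WF _ zW) (subsetP WF _ zW') yF yF' zy zy'.
    case: z zW => i _; case: y => j; case: z' zW' => i' _; case: y' => j' //=;
      move=> h1 h2 h3 h4 _ _ [E1 E2]; subst=> //.
      by rewrite h1 in h4.
    by rewrite h2 in h3.
  rewrite -(card_in_imset inj) -(card_imset (mem (S E)) (@Some_inj _)).
  apply: subset_leq_card; apply/subsetP=> _ /imsetP[[z y] zyP ->].
  case Eij : (edge_of (z, y)) => [ij|].
    by apply: imset_f; rewrite inE -Eij imset_f.
  move: zyP; rewrite pairsE /= => /andP[_ /avF[_]].
  by move: Eij; case: (z); case: (y).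
apply: le_trans (bip_prob_avoid p01 (n * e) SB SE); apply: bip_prob_le => // E.
case/andP=> big /forallP no; apply/andP; split.
  by apply: leq_trans (cS E); under eq_bigr do rewrite avE.
rewrite disjoint_sym disjoint_subset; apply/subsetP=> ij; rewrite inE => /imsetP[[z y]].
rewrite pairsE avE /= => /andP[zW yA] Eij; rewrite inE; apply/negP=> ijE.
have /implyP/(_ zW)/forallP/(_ y)/implyP/(_ yA)/negP := no z; apply.
by move: Eij; case: (z) => k; case: (y) => l //= [<-].
Qed.

End Blocked.

(** * Union bounds for the failure events *)

Section UnionBounds.
Variables (R : realType) (n K h : nat) (p : R).
Hypothesis p01 : 0 <= p <= 1.
Hypotheses (n_gt1 : (1 < n)%N) (K_gt0 : (0 < K)%N) (h_gt0 : (0 < h)%N).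
Hypothesis n2K : (2 * n <= 2 ^ K)%N.
Hypothesis ph : 1 <= p * h%:R.
Notation V := ('I_n + 'I_n)%type.
Local Notation e := (14 * (K * h))%N.

Let nK : (#|'I_n| <= 2 ^ K)%N.
Proof. by rewrite card_ord; move: n2K; clear; lia. Qed.

Lemma count_bound (c a b k : nat) : (c <= 2 ^ a)%N -> (a + k <= b)%N ->
  c%:R * (2 ^+ b)^-1 <= (2 ^+ k)^-1 :> R.
Proof.
move=> ca ab; have p0 m : 0 < 2 ^+ m :> R by rewrite exprn_gt0 ?ltr0n.
rewrite ler_pdivrMr // [_^-1 * _]mulrC ler_pdivlMr // -!natrX -natrM ler_nat.
by apply: leq_trans (leq_mul ca (leqnn _)) _; rewrite -expnD leq_exp2l.
Qed.

Lemma prob_rect_empty b (U W : {set 'I_n}) a : (h * a <= #|U| * #|W|)%N ->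
  bip_prob p (fun E => [disjoint E & rect b U W]) <= (2 ^+ a)^-1.
Proof.
move=> ha; apply: le_trans (bip_prob_disjoint p01 _) _; rewrite card_rect.
apply: le_trans (pow_half p01 a ph); apply: ler_wiXn2l => //.
  by rewrite subr_ge0; case/andP: p01.
by rewrite lerBlDr lerDl; case/andP: p01.
Qed.

(** At most 2^(2 K e) pairs of sets compete with the probability 2^(-14 K e), which comes from
    [e * e = h * (14 * K * e)]. *)
Lemma prob_no_edge : bip_prob p (@no_edge_event n e) <= (2 ^+ K)^-1.
Proof.
apply: le_trans (bip_prob_exists p01 (c := (2 ^+ (14 * (K * e)))^-1) _) _.
  move=> [U W] /= /andP[/eqP cU /eqP cW]; apply: (@prob_rect_empty true); rewrite cU cW.
  by clear; lia.
apply: (@count_bound _ (K * e + K * e)).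
  rewrite expnD; apply: leq_trans (leq_mul (card_sets_of_size e nK) (card_sets_of_size e nK)).
  by rewrite -cardX; apply: eq_leq; apply: eq_card => -[U W]; rewrite !inE.
by move: K_gt0 h_gt0; clear; nia.
Qed.

(** The complement of [Z] has at least [n / 2] vertices, so a rectangle is empty with probability at
    most 2^(-g K (D + 3)). Of the factor [D + 3], a share [D + 1] pays for the choice of [U] and
    [Z]; the rest leaves 2^(-2 K), half of whose exponent pays for the choice of [g]. *)
Lemma prob_no_expansion D b : (2 * (h * (K * (D + 3))) <= n)%N ->
  bip_prob p (no_expansion_event (n := n) D b) <= (2 ^+ K)^-1.
Proof.
move=> Dn; apply: le_trans (bip_prob_exists p01 (c := (2 ^+ (K + K))^-1) _) _; last first.
  apply: (@count_bound _ K) => //; apply: leq_trans (max_card _) _; rewrite card_ord.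
  by move: n_gt1 n2K; clear; lia.
move=> g /andP[g0 gD].
apply: le_trans (bip_prob_exists p01 (c := (2 ^+ (g * (K * (D + 3))))^-1) _) _.
  move=> [U Z] /= /andP[/eqP cU /eqP cZ]; apply: prob_rect_empty; rewrite cU.
  have cZ' : (#|Z| + #|~: Z| = n)%N by rewrite cardsC card_ord.
  have : (h * (K * (D + 3)) <= #|~: Z|)%N by move: cZ' gD Dn; rewrite cZ; clear; lia.
  by move=> le; rewrite mulnCA leq_mul2l le orbT.
apply: (@count_bound _ (K * g + K * (g * D))); last by move: g0 K_gt0; clear; nia.
rewrite expnD; apply: leq_trans (leq_mul (card_sets_of_size g nK) (card_sets_of_size (g * D)%N nK)).
by rewrite -cardX; apply: eq_leq; apply: eq_card => -[U W]; rewrite !inE.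
Qed.

Definition blocked_event (Y : rel V) (E : {set 'I_n * 'I_n}) :=
  [exists d : {perm V} * (({set V} * {set V}) * ({set V} * {set V})) * {set V * V},
     ((d.1.2.1.2 \subset d.1.2.1.1) && (#|d.2| <= n)%N) &&
     blocked n e (@left_side n) (bip_rel E) Y d.1.1 d.1.2.1.1 d.1.2.1.2 d.2 d.1.2.2.1 d.1.2.2.2].

Lemma blocked_eventN Y E : ~~ blocked_event Y E -> joint (@left_side n) n e (bip_rel E) Y.
Proof.
rewrite negb_exists => /forallP H; apply: joint_blocked => s F W Hs Q P WF cH.
by have := H (s, ((F, W), (Q, P)), Hs); rewrite /= WF cH.
Qed.

(** This needs the constant 14 in [e]: the state contributes [2 * K * n] to the exponent of the
    count, the four vertex sets [8 * n] and [H] about [2 * K * n], against [14 * K * n] from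
    [pow_half]. *)
Lemma prob_blocked_event Y : bip_prob p (blocked_event Y) <= (2 ^+ K)^-1.
Proof.
apply: le_trans (bip_prob_exists p01 (c := (2 ^+ (n * (14 * K)))^-1) _) _.
  move=> d /andP[WF cH]; apply: le_trans (prob_blocked p01 _ _ _ _ _ _ WF) _.
  apply: le_trans (pow_half p01 (n * (14 * K)) ph); rewrite le_eqVlt; apply/orP; left.
  by apply/eqP; congr (_ ^+ _); clear; lia.
have cV : #|{: V}| = (2 * n)%N by rewrite card_sum card_ord addnn mul2n.
have VK : (#|{: V}| <= 2 ^ K)%N by rewrite cV.
have VVK : (#|{: V * V}| <= 2 ^ (K + K))%N by rewrite card_prod expnD leq_mul.
have nKK : (n < 2 ^ (K + K))%N.
  rewrite expnD; move: n_gt1 n2K; move: (2 ^ K)%N => x; clear; nia.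
apply: (@count_bound _ (K * (2 * n) + 4 * (2 * n) + ((K + K) * n + (K + K)))); last first.
  by move: n_gt1 K_gt0; clear; nia.
apply: (@leq_trans (#|{: {perm V} * (({set V} * {set V}) * ({set V} * {set V}))}| *
    #|[pred H : {set V * V} | (#|H| <= n)%N]|)).
  rewrite -cardX; apply: subset_leq_card; apply/subsetP=> d; rewrite !inE.
  by case/andP.
rewrite [X in (_ <= X)%N]expnD; apply: leq_mul; last exact: card_sets_upto.
rewrite !card_prod !card_set_type cV [X in (_ <= X)%N]expnD.
apply: leq_mul; first by have := card_perm_type VK; rewrite cV.
by rewrite -!expnD; apply: eq_leq; congr (_ ^ _)%N; clear; lia.
Qed.

End UnionBounds.

(** * The probability of exactly two components *)

Section TwoComponentsProbability.
Variables (R : realType) (n K h : nat) (p : R).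
Hypothesis p01 : 0 <= p <= 1.
Hypotheses (n_gt1 : (1 < n)%N) (K_gt0 : (0 < K)%N) (h_gt0 : (0 < h)%N).
Hypothesis n2K : (2 * n <= 2 ^ K)%N.
Hypothesis ph : 1 <= p * h%:R.
Hypothesis n_big : (4096 * (4096 * (4096 * (K * K * K * (h * h)))) <= n)%N.
Let e := (14 * (K * h))%N.
Let D := (2 * (640 * (K * e)))%N.

Definition irregular (E : {set 'I_n * 'I_n}) := [|| no_edge_event e E,
  no_expansion_event D true E | no_expansion_event D false E].

Lemma prob_irregular : bip_prob p irregular <= 3 * (2 ^+ K)^-1.
Proof.
have Dn : (2 * (h * (K * (D + 3))) <= n)%N.
  apply: leq_trans n_big; rewrite /D /e; move: K_gt0 h_gt0; clear.
  have -> : (2 * (h * (K * (2 * (640 * (K * (14 * (K * h)))) + 3))) =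
    4480 * (8 * (K * K * K * (h * h))) + 6 * (K * h))%N by lia.
  case: K => // k; case: h => // l _ _.
  have : (k.+1 * l.+1 <= k.+1 * k.+1 * k.+1 * (l.+1 * l.+1))%N by nia.
  by move: (k.+1 * k.+1 * k.+1 * (l.+1 * l.+1))%N (k.+1 * l.+1)%N => x y; lia.
have h1 := prob_no_edge p01 K_gt0 h_gt0 n2K ph.
have h2 := prob_no_expansion p01 n_gt1 K_gt0 n2K ph true Dn.
have h3 := prob_no_expansion p01 n_gt1 K_gt0 n2K ph false Dn.
have -> : 3 * (2 ^+ K)^-1 = (2 ^+ K)^-1 + ((2 ^+ K)^-1 + (2 ^+ K)^-1) :> R by ring.
apply: le_trans (lerD h1 (lerD h2 h3)).
rewrite /bip_prob [X in X <= _]big_mkcond [X in _ <= X + _]big_mkcond.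
rewrite [X in _ <= _ + (X + _)]big_mkcond [X in _ <= _ + (_ + X)]big_mkcond.
rewrite -!big_split /=; apply: ler_sum => E _.
have m0 := bip_mass_ge0 p01 E.
rewrite /irregular -/e; case: (no_edge_event _ _); case: (no_expansion_event _ _ _);
  case: (no_expansion_event _ _ _) => /=; rewrite ?addr0 ?add0r ?lerDl ?addr_ge0 //.
Qed.

Lemma two_components_of_regular EX EY : ~~ irregular EX -> ~~ irregular EY ->
  ~~ blocked_event K h (bip_rel EY) EX ->
  ncomponents (FS (bip_graph EX) (bip_graph EY)) = 2.
Proof.
rewrite /irregular !negb_or => /and3P[x1 x2 x3] /and3P[y1 y2 y3] xy.
have xD b : ~~ no_expansion_event D b EX by case: b.
have yD b : ~~ no_expansion_event D b EY by case: b.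
apply: (@pseudorandom_two_components _ (@left_side n) n K h) => //.
- exact: card_left_side.
- by move: n2K n_gt1; clear; lia.
- exact: bip_rel_bipartite.
- exact: bip_rel_bipartite.
- exact: no_edge_eventN.
- exact: no_edge_eventN.
- exact: no_expansion_eventN.
- exact: no_expansion_eventN.
- exact: blocked_eventN.
Qed.

(** The 7 counts three failure events for each graph and the blocked event for the pair. *)
Lemma two_components_prob : 1 - 7 * (2 ^+ K)^-1 <=
  bip_pair_prob p (fun X Y : sgraph ('I_n + 'I_n)%type => ncomponents (FS X Y) == 2%N).
Proof.
set c := (2 ^+ K)^-1; rewrite lerBlDr.
pose m E := bip_mass p (E : {set 'I_n * 'I_n}).
have m0 E : 0 <= m E := bip_mass_ge0 p01 E.
have m1 : \sum_E m E = 1 := bip_mass_sum1 n p.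
pose ok EX EY := ncomponents (FS (bip_graph EX) (bip_graph EY)) == 2%N.
have e1 : \sum_EX \sum_EY (if irregular EX then m EX * m EY else 0) <= 3 * c.
  apply: le_trans prob_irregular; rewrite /bip_prob [X in _ <= X]big_mkcond.
  apply: ler_sum => EX _; case: ifP => _; last by rewrite big1.
  by rewrite -mulr_sumr m1 mulr1.
have e2 : \sum_EX \sum_EY (if irregular EY then m EX * m EY else 0) <= 3 * c.
  rewrite exchange_big; apply: le_trans e1; rewrite le_eqVlt; apply/orP; left.
  by apply/eqP; apply: eq_bigr => EX _; apply: eq_bigr => EY _; rewrite mulrC.
(* Here [EY] is fixed first, and the bound for random [EX] is uniform in it. *)
have e3 : \sum_EX \sum_EY (if blocked_event K h (bip_rel EY) EX then m EX * m EY else 0) <= c.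
  rewrite exchange_big /= -[X in _ <= X]mul1r -m1 mulr_suml; apply: ler_sum => EY _.
  have := prob_blocked_event p01 n_gt1 K_gt0 n2K ph (bip_rel EY).
  move=> /(ler_wpM2l (m0 EY)); apply: le_trans.
  rewrite /bip_prob [X in _ <= _ * X]big_mkcond mulr_sumr; apply: ler_sum => EX _.
  by case: ifP => _; rewrite ?mulr0 // mulrC.
have -> : 7 * c = 3 * c + (3 * c + c) by ring.
apply: le_trans (lerD (lexx _) (lerD e1 (lerD e2 e3))).
have -> : 1 = \sum_EX \sum_EY m EX * m EY :> R.
  by rewrite -m1; apply: eq_bigr => EX _; rewrite -mulr_sumr m1 mulr1.
rewrite /bip_pair_prob -!big_split /=; apply: ler_sum => EX _.
rewrite [X in _ <= X + _]big_mkcond -!big_split /=; apply: ler_sum => EY _.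
have mm : 0 <= m EX * m EY by rewrite mulr_ge0.
case: ifP => [_|/negbT no]; first by rewrite lerDl !addr_ge0 //; case: ifP.
rewrite add0r; case: (boolP (irregular EX)) => [_|x]; first by rewrite lerDl addr_ge0 //; case: ifP.
case: (boolP (irregular EY)) => [_|y]; first by rewrite add0r lerDl; case: ifP.
case: (boolP (blocked_event _ _ _ _)) => [_|xy]; first by rewrite !add0r.
by case/eqP: no; apply: two_components_of_regular.
Qed.

Lemma bip_pair_prob_le1 A : bip_pair_prob (n := n) p A <= 1.
Proof.
rewrite -(bip_mass_sum1 n p) /bip_pair_prob; apply: ler_sum => EX _.
rewrite -mulr_sumr -[X in _ <= X]mulr1; apply: ler_wpM2l; first exact: bip_mass_ge0.
exact: (bip_prob_le1 p01 (fun EY => A (bip_graph EX) (bip_graph EY))).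
Qed.

End TwoComponentsProbability.

(** * Analytic estimates and the limit *)

Unset Implicit Arguments.
Set Strict Implicit.
Set Printing Implicit Defensive.

From mathcomp Require Import all_classical all_reals all_analysis.

Import numFieldNormedType.Exports.
Local Open Scope classical_set_scope.
Local Open Scope ring_scope.

(** With y = x^(4/5) one has x^4 = y^5, and y is at most exp(4 y); raise this to the fifth power. *)
Lemma expR_ge_pow4 (R : realType) (x : R) : 0 <= x ->
  x ^+ 4 <= expR (20 * x `^ (4 / 5)).
Proof.
move=> x0; set y := x `^ (4 / 5).
have y0 : 0 <= y := powR_ge0 _ _.
have -> : x ^+ 4 = y ^+ 5.
  rewrite -(powR_mulrn _ y0) -powRrM (_ : 4 / 5 * 5%:R = 4%:R) ?powR_mulrn //.
  by field.
have -> : 20 * y = 5%:R * (4 * y) by ring.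
rewrite expRM_natl; apply: lerXn2r; rewrite ?nnegrE ?expR_ge0 //.
by apply: le_trans (expR_ge1Dx _); lra.
Qed.

(** Take [K] just above log2(2 n) and [h] just above 1/p. Then K is at most c ln n and h^2 at most 4
    n / y^2, where y^2 is at least (ln n)^4. So b^3 K^3 h^2 is at most a constant times n / ln n,
    whatever [b] is. *)
Lemma parameters_exist (R : realType) (b : nat) : exists N : nat, forall (n : nat) (p : R),
  (N <= n)%N -> 0 <= p <= 1 ->
  expR (10 * (ln (n%:R : R)) `^ (4 / 5)) / (n%:R : R) `^ (1 / 2) <= p ->
  exists K h : nat, [/\ (0 < K)%N, (0 < h)%N, (2 * n <= 2 ^ K)%N, 1 <= p * h%:R &
    (b * (b * (b * (K * K * K * (h * h)))) <= n)%N].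
Proof.
have ln2 : 0 < ln (2 : R) by rewrite ln_gt0 // ltr1n.
pose c : R := (ln 2)^-1 + 2; have c0 : 0 < c by rewrite addr_gt0 ?invr_gt0.
(* All constants are collected in [a], which [ln n] exceeds for large [n]. *)
pose a : R := 4 * b%:R ^+ 3 * c ^+ 3.
exists (Num.trunc (expR (a + 1))).+1 => n p Nn /andP[p0 p1] pn.
have n_exp : expR (a + 1) <= n%:R.
  have /andP[_ /ltW h] := truncn_itv (expR_ge0 (a + 1)).
  by apply: le_trans h _; rewrite ler_nat.
have n0 : 0 < n%:R :> R by apply: lt_le_trans n_exp; apply: expR_gt0.
have n1 : (0 < n)%N by rewrite -(ltr0n R).
set x := ln n%:R in pn.
have a0 : 0 <= a by rewrite !mulr_ge0 ?exprn_ge0 // ltW.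
have xa : a + 1 <= x by rewrite -[a + 1]expRK ler_ln ?posrE ?expR_gt0.
have x1 : 1 <= x by apply: le_trans xa; lra.
have x0 : 0 <= x by apply: le_trans x1.
pose k := trunc_log 2 (2 * n); exists k.+1.
have n2 : (0 < 2 * n)%N by rewrite muln_gt0.
have /andP[k1 k2] := trunc_log_bounds (isT : (1 < 2)%N) n2; rewrite -/k in k1 k2.
have Kx : (k.+1)%:R <= c * x.
  have kn : (2 : R) ^+ k <= 2 * n%:R by rewrite -natrX -natrM ler_nat.
  have : ln (2 ^+ k) <= ln (2 * n%:R : R).
    by rewrite ler_ln ?posrE ?exprn_gt0 ?mulr_gt0 ?ltr0n.
  rewrite lnXn ?ltr0n // lnM ?posrE ?ltr0n // -[ln 2 *+ k]mulr_natr -/x => le1.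
  have : k%:R <= 1 + x / ln 2.
    have lnx : ln 2 * (x / ln 2) = x by rewrite mulrC divfK // gt_eqF.
    by rewrite -(ler_pM2l ln2) mulrDr mulr1 lnx.
  by rewrite /c -natr1 mulrDl [(ln 2)^-1 * x]mulrC; lra.
set y := expR (10 * x `^ (4 / 5)) in pn.
have y0 : 0 < y := expR_gt0 _.
have s0 : 0 < (n%:R : R) `^ (1 / 2) by apply: powR_gt0.
have s2 : ((n%:R : R) `^ (1 / 2)) ^+ 2 = n%:R.
  rewrite -powR_mulrn ?powR_ge0 // -powRrM (_ : 1 / 2 * 2%:R = 1) ?powRr1 ?ler0n //.
  by field.
have pp : 0 < p by apply: lt_le_trans pn; apply: divr_gt0.
exists (Num.trunc p^-1).+1; set h := (Num.trunc p^-1).+1.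
have pV : 0 <= p^-1 by rewrite invr_ge0.
have /andP[h1 h2] := truncn_itv pV; rewrite -/h in h2.
have h1' : h%:R <= 2 * p^-1.
  have : 1 <= p^-1 by rewrite invf_ge1.
  by move: h1; rewrite /h -natr1; lra.
split=> //.
- exact: ltnW.
- by rewrite -[X in X <= _](mulfV (lt0r_neq0 pp)) ler_pM2l // ltW.
have hh : h%:R ^+ 2 * y ^+ 2 <= 4 * n%:R.
  have hy : h%:R * y <= 2 * (n%:R : R) `^ (1 / 2).
    rewrite ler_pdivrMr // in pn.
    have : h%:R * y <= 2 * p^-1 * (p * (n%:R : R) `^ (1 / 2)).
      by apply: ler_pM => //; apply: ltW.
    by rewrite mulrA -[2 * _ * p]mulrA mulVf ?gt_eqF // mulr1.
  rewrite -exprMn -s2 (_ : 4 = 2 ^+ 2) -?exprMn; last by ring.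
  by apply: lerXn2r; rewrite ?nnegrE ?mulr_ge0 // ltW.
have yy : x ^+ 4 <= y ^+ 2.
  rewrite /y -expRM_natl (_ : 2%:R * _ = 20 * x `^ (4 / 5)); first exact: expR_ge_pow4.
  by ring.
have KK : (k.+1)%:R ^+ 3 <= c ^+ 3 * x ^+ 3.
  by rewrite -exprMn; apply: lerXn2r; rewrite ?nnegrE ?mulr_ge0 // ltW.
have ax : a * x ^+ 3 <= x ^+ 4.
  by rewrite [x ^+ 4]exprS; apply: ler_wpM2r; [apply: exprn_ge0 | lra].
rewrite -(ler_nat R) !natrM.
have -> : b%:R * (b%:R * (b%:R * ((k.+1)%:R * (k.+1)%:R * (k.+1)%:R * (h%:R * h%:R)))) =
  b%:R ^+ 3 * (k.+1)%:R ^+ 3 * h%:R ^+ 2 :> R by ring.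
rewrite -(ler_pM2l (_ : 0 < 4)) //; apply: le_trans hh.
have -> : 4 * (b%:R ^+ 3 * (k.+1)%:R ^+ 3 * h%:R ^+ 2) =
  h%:R ^+ 2 * (4 * b%:R ^+ 3 * (k.+1)%:R ^+ 3) :> R by ring.
apply: ler_wpM2l; first exact: exprn_ge0.
apply: le_trans yy; apply: le_trans ax; rewrite /a -[X in _ <= X]mulrA.
by apply: ler_wpM2l => //; rewrite mulr_ge0 // exprn_ge0.
Qed.

Theorem theorem1p2 (R : realType) (p : nat -> R)
  (p01 : forall n : nat, 0 <= p n <= 1)
  (p_large : \forall n \near \oo,
     expR (10 * (ln (n%:R : R)) `^ (4 / 5)) / (n%:R : R) `^ (1 / 2) <= p n) :
  bip_pair_prob (p n)
    (fun X Y : sgraph ('I_n + 'I_n)%type => ncomponents (FS X Y) == 2%N)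
    @[n --> \oo] --> (1 : R).
Proof.
have [N par] := parameters_exist R 4096.
apply/cvgrPdist_le => eps eps0; near=> n.
have [||K [h [K0 h0 nK ph big]]] := par n (p n) _ (p01 n).
- by near: n; apply: nbhs_infty_ge.
- by near: n.
have n1 : (1 < n)%N by near: n; apply: nbhs_infty_gt.
have n0 : 0 < n%:R :> R by rewrite ltr0n ltnW.
have n7 : 7 / eps <= n%:R by near: n; apply: nbhs_infty_ger.
have lo := two_components_prob (p01 n) n1 K0 h0 nK ph big.
have hi := bip_pair_prob_le1 (p01 n)
  (fun X Y : sgraph ('I_n + 'I_n)%type => ncomponents (FS X Y) == 2%N).
rewrite ger0_norm ?subr_ge0 //.
(* Since [2 ^ K >= n], the failure probability is at most [7 / n]. *)
have : 7 * (2 ^+ K)^-1 <= eps.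
  have K2 : n%:R <= 2 ^+ K :> R by rewrite -natrX ler_nat; apply: leq_trans nK; rewrite leq_pmull.
  rewrite ler_pdivrMr ?exprn_gt0 ?ltr0n // mulrC -ler_pdivrMr //.
  exact: le_trans K2.
by lra.
Unshelve. all: by end_near.
Qed.
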